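(* Let $G$ be a group, let $R$ be a unital commutative ring, and let $V$ be a representation of $G$ over $R$ which is free and finitely generated as an $R$-module. Let $n \in \mathbb{N}$ and let $\lambda$ be a partition of $n$. Fix a totally ordered $R$-basis $\mathcal{B}$ of $V$. Then there are isomorphisms of $RG$-modules $$\Delta^\lambda(V)\ \cong\ \mathsf{copolytab}^\lambda(V)\ \cong\ \mathrm{Sym}_\lambda(V)\big/\mathsf{DG}^\lambda(V),$$ where $\Delta^\lambda$ is the Weyl endofunctor, $\mathsf{copolytab}^\lambda(V)$ is the space of copolytabloids, and $\mathsf{DG}^\lambda(V)$ is the space of dual Garnir relations.
   Context: Partitions and tableaux. A partition $\lambda$ of $n$ is a weakly decreasing finite sequence of positive integers with sum $n=|\lambda|$; put $\lambda_i=0$ for $i$ larger than the number of parts. The conjugate $\lambda'$ is $\lambda'_i=|\{j\ge 1 : \lambda_j\ge i\}|$. The Young diagram is $[\lambda]=\{(i,j): 1\le i\le \lambda'_1,\ 1\le j\le\lambda_i\}$; its elements are boxes; $\mathrm{row}_i(\lambda)$ and $\mathrm{col}_j(\lambda)$ are the sets of boxes $(i,\cdot)$ and $(\cdot,j)$ respectively. For a basis $\mathcal{B}$ of $V$, a tableau (with entries in $\mathcal{B}$) is a function $t:[\lambda]\to\mathcal{B}$. The free $R$-module on the set of tableaux is identified with $V^{\otimes n}$ (tensor factors indexed by the boxes of $[\lambda]$), with diagonal $G$-action. Place permutations. For a set $X$, $S_X$ is its group of permutations, written on the right. $S_{[\lambda]}$ acts on tableaux on the right by $(t\cdot\sigma)(b)=t(b\sigma^{-1})$.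 Let $\mathrm{RPP}(\lambda)=\prod_i S_{\mathrm{row}_i(\lambda)}$ and $\mathrm{CPP}(\lambda)=\prod_j S_{\mathrm{col}_j(\lambda)}$, subgroups of $S_{[\lambda]}$. Let $\mathrm{rstab}(t)$ be the stabiliser of $t$ in $\mathrm{RPP}(\lambda)$. Two tableaux $t,u$ are row equivalent, $t\sim_{\mathrm r}u$, if for every $i$ they have the same multiset of entries in row $i$. For a subgroup $I$ of a group $S$, $I\backslash S$ denotes a set of representatives of the right cosets $I\sigma$. Symmetric and exterior powers. $\mathrm{Sym}^\lambda(V)=\bigotimes_{i=1}^{\lambda'_1}\mathrm{Sym}^{\lambda_i}V$, where $\mathrm{Sym}^rV$ is the usual symmetric power (a quotient of $V^{\otimes r}$); the image of a tableau $t$ in $\mathrm{Sym}^\lambda(V)$ (multiplying the entries within each row) is denoted $[t]$. $\mathrm{Sym}_r V\subseteq V^{\otimes r}$ is the submodule of symmetric tensors, and $\mathrm{Sym}_\lambda(V)=\bigotimes_{i=1}^{\lambda'_1}\mathrm{Sym}_{\lambda_i}V\subseteq V^{\otimes n}$ (the $i$th factor occupying the boxes of row $i$). $\bigwedge^{\lambda'}(V)=\bigotimes_{j=1}^{\lambda_1}\bigwedge^{\lambda'_j}V$; the image of a tableau $t$ under the projection $V^{\otimes n}\to\bigwedge^{\lambda'}(V)$ is $|t|=\bigotimes_{j}\big(t(1,j)\wedge\cdots\wedge t(\lambda'_j,j)\big)$. Schur and Weyl endofunctors. The polytabloid of $t$ is $\mathrm{e}(t)=\sum_{\sigma\in\mathrm{CPP}(\lambda)}\mathrm{sgn}(\sigma)\,[t\cdot\sigma]\in\mathrm{Sym}^\lambda(V)$,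 and $\mathsf{polytab}^\lambda(V)\subseteq\mathrm{Sym}^\lambda(V)$ is the $R$-span of the polytabloids. The Schur endofunctor $\nabla^\lambda$ is $\nabla^\lambda(V)=\mathsf{polytab}^\lambda(V)$; equivalently, up to isomorphism, it is the quotient of $\bigwedge^{\lambda'}(V)$ by the $R$-span of the Garnir relations $\sum_{\tau}\mathrm{sgn}(\tau)|t\cdot\tau|$, where $t$ is a tableau, $A\subseteq\mathrm{col}_j(\lambda)$, $B\subseteq\mathrm{col}_{j'}(\lambda)$ with $1\le j<j'\le\lambda_1$ and $|A|+|B|>\lambda'_j$, and $\tau$ runs over representatives of the left cosets $\tau(S_A\times S_B)$ in $S_{A\sqcup B}$. For a representation $U$ of $G$, $U^*=\mathrm{Hom}_R(U,R)$ with $(gf)(v)=f(g^{-1}v)$. The Weyl endofunctor is $\Delta^\lambda(V)=(\nabla^\lambda(V^* ))^*$. Copolytabloids. The row symmetrisation of a tableau $t$ is $\mathrm{rsym}(t)=\sum_{\tau\in \mathrm{rstab}(t)\backslash\mathrm{RPP}(\lambda)} t\cdot\tau\in\mathrm{Sym}_\lambda(V)$. The copolytabloid of $t$ is $\mathrm{c}(t)=\sum_{\tau\in\mathrm{rstab}(t)\backslash\mathrm{RPP}(\lambda)}|t\cdot\tau|\in\bigwedge^{\lambda'}(V)$, and $\mathsf{copolytab}^\lambda(V)\subseteq\bigwedge^{\lambda'}(V)$ is the $R$-span of all copolytabloids (it is the image of $\mathrm{Sym}_\lambda(V)$ under the projection $V^{\otimes n}\to\bigwedge^{\lambda'}(V)$).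 Dual Garnir relations. Let $t$ be a tableau, $1\le i<i'\le\lambda'_1$, and $A\subseteq\mathrm{row}_i(\lambda)$, $B\subseteq\mathrm{row}_{i'}(\lambda)$ with $|A|+|B|>\lambda_i$. Let $\mathcal{T}=\{t\cdot\tau : \tau\in S_{A\sqcup B}\}$ (a set, not a multiset), and let $\mathcal{T}/{\sim_{\mathrm r}}$ be a set of representatives, chosen in $\mathcal{T}$, for the row equivalence classes of elements of $\mathcal{T}$. The dual Garnir relation labelled by $(t,A,B)$ is $$D_{(t,A,B)}=\sum_{u\in\mathcal{T}/{\sim_{\mathrm r}}}\big|\,\mathrm{rstab}(u):\mathrm{rstab}(u)\cap(S_{A\sqcup B}\times S_{[\lambda]\setminus (A\sqcup B)})\,\big|\ \mathrm{rsym}(u)\in\mathrm{Sym}_\lambda(V),$$ where $|X:Y|$ is the index of the subgroup $Y$ in $X$ (this does not depend on the choice of representatives). $\mathsf{DG}^\lambda(V)\subseteq\mathrm{Sym}_\lambda(V)$ is the $R$-span of all dual Garnir relations; it is an $RG$-submodule of $\mathrm{Sym}_\lambda(V)$. *)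

(* Defs.v *)
From HB Require Import structures.
From mathcomp Require Import all_boot generic_quotient.
From mathcomp Require Import all_order all_fingroup all_algebra.
From mathcomp Require Import boolp functions.

Set Implicit Arguments.
Unset Strict Implicit.
Unset Printing Implicit Defensive.
Import GRing.Theory.
Local Open Scope ring_scope.

Section Modules.
Variables (R : comPzRingType).
Implicit Type V : lmodType R.

Definition Rspan V (P : V -> Prop) : {pred V} := fun x =>
  `[< exists2 s : seq (R * V), {in s, forall p, P p.2}
                             & x = \sum_(p <- s) p.1 *: p.2 >].

Lemma RspanP V (P : V -> Prop) x :
  reflect (exists2 s : seq (R * V), {in s, forall p, P p.2}
                             & x = \sum_(p <- s) p.1 *: p.2) (x \in Rspan P).
Proof. exact: asboolP. Qed.

Lemma Rspan_subsemimod V (P : V -> Prop) : subsemimod_closed (Rspan P).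
Proof.
split; first split.
- by apply/RspanP; exists [::] => //; rewrite big_nil.
- move=> _ _ /RspanP[s sP ->] /RspanP[r rP ->]; apply/RspanP; exists (s ++ r).
    by move=> p; rewrite mem_cat => /orP[]; [exact: sP|exact: rP].
  by rewrite big_cat.
- move=> a _ /RspanP[s sP ->]; apply/RspanP; exists [seq (a * p.1, p.2) | p <- s].
    by move=> _ /mapP[p ps ->]; exact: (sP p ps).
  by rewrite big_map scaler_sumr; apply: eq_bigr => p _; rewrite scalerA.
Qed.

HB.instance Definition _ V (P : V -> Prop) :=
  GRing.isSubmodClosed.Build R V (Rspan P) (Rspan_subsemimod P).

Lemma mem_Rspan V (P : V -> Prop) x : P x -> x \in Rspan P.
Proof.
move=> Px; apply/RspanP; exists [:: (1, x)]; last by rewrite big_seq1 scale1r.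
by move=> p; rewrite inE => /eqP ->.
Qed.

Lemma Rspan_ind V (P : V -> Prop) (S : submodClosed V) :
  (forall x, P x -> x \in S) -> {subset Rspan P <= S}.
Proof.
move=> PS _ /RspanP[s sP ->]; rewrite big_seq; apply: rpred_sum => p ps.
by apply: rpredZ; apply: PS; exact: sP.
Qed.

Definition submod V (S : submodClosed V) : Type := {x : V | x \in S}.
HB.instance Definition _ V (S : submodClosed V) := SubChoice.on (submod S).
HB.instance Definition _ V (S : submodClosed V) :=
  [SubChoice_isSubLmodule of submod S by <:].

Definition zmod_pred V (S : submodClosed V) : {pred V} := fun x => x \in S.
Lemma zmod_pred_closed V (S : submodClosed V) : zmod_closed (zmod_pred S).
Proof.
have zE x : (x \in zmod_pred S) = (x \in S) by [].
split=> [|x y]; rewrite !zE ?rpred0 // => xS yS.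
by rewrite -scaleN1r rpredD ?rpredZ.
Qed.
HB.instance Definition _ V (S : submodClosed V) :=
  GRing.isZmodClosed.Build V (zmod_pred S) (zmod_pred_closed S).

Definition quotmod V (S : submodClosed V) : Type := Quotient.quot (zmod_pred S).
HB.instance Definition _ V (S : submodClosed V) := GRing.Zmodule.on (quotmod S).

Definition qproj V (S : submodClosed V) (x : V) : quotmod S :=
  \pi_(Quotient.quot (zmod_pred S))%qT x.

Lemma qproj_eq V (S : submodClosed V) x y :
  qproj S x = qproj S y <-> x - y \in S.
Proof.
rewrite -[_ \in S]/(x - y \in zmod_pred S) Quotient.idealrBE.
by split=> [/eqP|/eqP].
Qed.

Lemma qproj_surj V (S : submodClosed V) (q : quotmod S) : {x | q = qproj S x}.
Proof. by exists (generic_quotient.repr (q : Quotient.quot (zmod_pred S))); rewrite /qproj reprK. Qed.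

Lemma qproj_zmod V (S : submodClosed V) : zmod_morphism (qproj S).
Proof. by move=> x y; rewrite /qproj !piE. Qed.
HB.instance Definition _ V (S : submodClosed V) :=
  GRing.isZmodMorphism.Build V (quotmod S) (qproj S) (@qproj_zmod V S).

Definition qscale V (S : submodClosed V) (a : R) (q : quotmod S) : quotmod S :=
  qproj S (a *: generic_quotient.repr (q : Quotient.quot (zmod_pred S))).

Lemma qscaleE V (S : submodClosed V) a x :
  qscale a (qproj S x) = qproj S (a *: x).
Proof.
apply/qproj_eq; rewrite -scalerBr; apply: rpredZ; apply/qproj_eq.
by rewrite /qproj reprK.
Qed.

Lemma qscaleA V (S : submodClosed V) a c (q : quotmod S) :
  qscale a (qscale c q) = qscale (a * c) q.
Proof. by have [x ->] := qproj_surj q; rewrite !qscaleE scalerA. Qed.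
Lemma qscale1 V (S : submodClosed V) : left_id 1 (@qscale V S).
Proof. by move=> q; have [x ->] := qproj_surj q; rewrite qscaleE scale1r. Qed.
Lemma qscaleDr V (S : submodClosed V) : right_distributive (@qscale V S) +%R.
Proof.
move=> a q r; have [x ->] := qproj_surj q; have [y ->] := qproj_surj r.
by rewrite -raddfD !qscaleE scalerDr raddfD.
Qed.
Lemma qscaleDl V (S : submodClosed V) (q : quotmod S) :
  {morph (@qscale V S)^~ q : a c / a + c}.
Proof.
by move=> a c; have [x ->] := qproj_surj q; rewrite !qscaleE scalerDl raddfD.
Qed.
HB.instance Definition _ V (S : submodClosed V) :=
  GRing.Zmodule_isLmodule.Build R (quotmod S)
    (@qscaleA V S) (@qscale1 V S) (@qscaleDr V S) (@qscaleDl V S).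

Lemma qproj_scalable V (S : submodClosed V) : scalable (qproj S).
Proof. by move=> a x; rewrite -qscaleE. Qed.
HB.instance Definition _ V (S : submodClosed V) :=
  GRing.isScalable.Build R V (quotmod S) *:%R (qproj S) (@qproj_scalable V S).

(* Hom_R(V, R). *)
Definition linear_forms V : {pred (V -> R^o)} :=
  fun f => `[< scalar (f : V -> R) >].
Lemma linear_formsP V (f : V -> R^o) :
  reflect (scalar (f : V -> R)) (f \in @linear_forms V).
Proof. exact: asboolP. Qed.
Lemma linear_forms_subsemimod V : subsemimod_closed (@linear_forms V).
Proof.
split; first split.
- apply/linear_formsP => a x y; have E z : (0 : V -> R^o) z = 0 :> R by [].
  by rewrite !E mulr0 addr0.
- move=> f g /linear_formsP fl /linear_formsP gl; apply/linear_formsP => a x y.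
  have E z : (f + g) z = (f z : R) + g z by [].
  by rewrite !E fl gl mulrDr addrACA.
- move=> c f /linear_formsP fl; apply/linear_formsP => a x y.
  have E z : (c *: f) z = c * (f z : R) by [].
  by rewrite !E fl mulrDr !mulrA [c * a]mulrC.
Qed.
HB.instance Definition _ V :=
  GRing.isSubmodClosed.Build R (V -> R^o) (@linear_forms V)
    (@linear_forms_subsemimod V).
Local Notation dualmod V := (submod (@linear_forms V)).

Definition is_basis (B : finType) V (b : B -> V) :=
  forall v, exists! c : {ffun B -> R}, v = \sum_i c i *: b i.

Record basis (B : finType) V := Basis {
  bvec :> B -> V;
  bvecP : is_basis bvec }.

Definition bcoord (B : finType) V (b : basis B V) (i : B) (v : V) : R :=
  projT1 (cid (bvecP b v)) i.

Section Coord.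
Variables (B : finType) (V : lmodType R) (b : basis B V).

Lemma bcoordK v : v = \sum_i bcoord b i v *: b i.
Proof. by rewrite /bcoord; case: cid => c []. Qed.

Lemma bcoord_uniq v (c : B -> R) : v = \sum_i c i *: b i -> bcoord b ^~ v =1 c.
Proof.
move=> vE i; rewrite /bcoord; case: cid => d [_ dU] /=.
rewrite (dU [ffun i => c i]) ?ffunE // vE.
by apply: eq_bigr => j _; rewrite ffunE.
Qed.

Lemma bcoord_scalar i : scalar (bcoord b i).
Proof.
move=> a u v /=.
rewrite (@bcoord_uniq _ (fun i => a * bcoord b i u + bcoord b i v)) //.
rewrite {1}(bcoordK u) {1}(bcoordK v) scaler_sumr -big_split /=.
by apply: eq_bigr => j _; rewrite scalerDl scalerA.
Qed.
HB.instance Definition _ i :=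
  GRing.isLinear.Build R V R *%R (bcoord b i) (bcoord_scalar i).

Lemma bcoord_basis i j : bcoord b i (b j) = (i == j)%:R.
Proof.
rewrite (@bcoord_uniq _ (fun i => (i == j)%:R)) // (bigD1 j) //= eqxx scale1r.
by rewrite big1 ?addr0 // => k /negPf ->; rewrite scale0r.
Qed.

Lemma bcoord_dualP i : (bcoord b i : V -> R^o) \in @linear_forms V.
Proof. by apply/linear_formsP; exact: bcoord_scalar. Qed.

Definition dual_vec (i : B) : dualmod V := @exist _ (fun f => f \in @linear_forms V) _ (bcoord_dualP i).

Lemma dual_sumE (c : B -> R) v :
  val (\sum_i c i *: dual_vec i) v = \sum_i c i * bcoord b i v.
Proof. by rewrite raddf_sum fct_sumE; apply: eq_bigr => i _. Qed.

Lemma dual_vecP : is_basis dual_vec.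
Proof.
move=> f; have /linear_formsP fl := valP f.
pose L := GRing.isLinear.Build R V R *%R (val f : V -> R) fl.
pose F : {scalar V} := HB.pack (val f : V -> R) L.
have fE v : val f v = F v by [].
exists [ffun i => F (b i)]; split.
  apply/val_inj/funext => v; rewrite dual_sumE fE {1}(bcoordK v) linear_sum.
  by apply: eq_bigr => i _; rewrite linearZ ffunE mulrC.
move=> c fc; apply/ffunP => i; rewrite ffunE -fE fc dual_sumE (bigD1 i) //=.
rewrite bcoord_basis eqxx mulr1 big1 ?addr0 // => j /negPf ji.
by rewrite bcoord_basis ji mulr0.
Qed.
Definition dual_basis : basis B (dualmod V) := Basis dual_vecP.
End Coord.
End Modules.

Notation dualmod V := (submod (@linear_forms _ V)).

Record rep (G : groupType) (R : comPzRingType) := Rep {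
  rep_mod :> lmodType R;
  rep_act : G -> rep_mod -> rep_mod;
  rep_act_linear : forall g, linear (rep_act g);
  rep_act1 : forall v, rep_act 1%g v = v;
  rep_actM : forall g h v, rep_act (g * h)%g v = rep_act g (rep_act h v) }.

HB.instance Definition _ G R (V : rep G R) (g : G) :=
  GRing.isLinear.Build R V V *:%R (@rep_act G R V g) (@rep_act_linear G R V g).

Lemma rep_actZ G R (V : rep G R) g a (v : V) :
  rep_act g (a *: v) = a *: rep_act g v.
Proof. exact: linearZ. Qed.

Lemma rep_act_sum G R (V : rep G R) g (I : Type) (r : seq I) (P : pred I)
    (F : I -> V) :
  rep_act g (\sum_(i <- r | P i) F i) = \sum_(i <- r | P i) rep_act g (F i).
Proof. exact: linear_sum. Qed.

Definition rep_iso G R (U V : rep G R) :=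
  exists f : {linear U -> V}, bijective f /\ forall g u, f (rep_act g u) = rep_act g (f u).

Section Representations.
Variables (G : groupType) (R : comPzRingType).
Implicit Type V : rep G R.

Definition stable V (S : {pred V}) :=
  forall g v, v \in S -> rep_act g v \in S.

Lemma Rspan_stable V (P : V -> Prop) :
  (forall g v, P v -> rep_act g v \in Rspan P) -> stable (Rspan P).
Proof.
move=> PS g _ /RspanP[s sP ->]; rewrite linear_sum big_seq.
apply: rpred_sum => p ps; rewrite linearZ; apply: rpredZ; apply: PS.
exact: (sP p ps).
Qed.

Section Sub.
Variables (V : rep G R) (S : submodClosed V) (hS : stable S).
Definition sub_act (g : G) (v : submod S) : submod S :=
  exist (fun x => x \in S) (rep_act g (val v)) (hS g (valP v)).
Lemma sub_act_linear g : linear (sub_act g).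
Proof. by move=> a u v; apply: val_inj; rewrite /= !linearP. Qed.
Lemma sub_act1 v : sub_act 1%g v = v.
Proof. by apply: val_inj; rewrite /= rep_act1. Qed.
Lemma sub_actM g h v : sub_act (g * h)%g v = sub_act g (sub_act h v).
Proof. by apply: val_inj; rewrite /= rep_actM. Qed.
Definition sub_rep : rep G R := Rep sub_act_linear sub_act1 sub_actM.
End Sub.

Section Quot.
Variables (V : rep G R) (S : submodClosed V) (hS : stable S).
Definition quot_act (g : G) (q : quotmod S) : quotmod S :=
  qproj S (rep_act g (generic_quotient.repr (q : Quotient.quot (zmod_pred S)))).
Lemma quot_actE g v : quot_act g (qproj S v) = qproj S (rep_act g v).
Proof.
apply/qproj_eq; rewrite -linearB; apply: hS; apply/qproj_eq.
by rewrite /qproj reprK.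
Qed.
Lemma quot_act_linear g : linear (quot_act g).
Proof.
move=> a q r; have [x ->] := qproj_surj q; have [y ->] := qproj_surj r.
by rewrite -linearP !quot_actE !linearP.
Qed.
Lemma quot_act1 q : quot_act 1%g q = q.
Proof. by have [x ->] := qproj_surj q; rewrite quot_actE rep_act1. Qed.
Lemma quot_actM g h q : quot_act (g * h)%g q = quot_act g (quot_act h q).
Proof. by have [x ->] := qproj_surj q; rewrite !quot_actE rep_actM. Qed.
Definition quot_rep : rep G R := Rep quot_act_linear quot_act1 quot_actM.
End Quot.

(* The contragredient representation, (g f)(v) = f(g^-1 v). *)
Section Dual.
Variable V : rep G R.
Lemma dual_act_subproof (g : G) (f : dualmod V) :
  (fun v => val f (rep_act g^-1%g v)) \in @linear_forms R V.
Proof.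
have /linear_formsP fl := valP f.
by apply/linear_formsP => a u v; rewrite linearP fl.
Qed.
Definition dual_act (g : G) (f : dualmod V) : dualmod V :=
  @exist _ (fun f => f \in @linear_forms R V) _ (dual_act_subproof g f).
Lemma dual_act_linear g : linear (dual_act g).
Proof. by move=> a f h; apply: val_inj. Qed.
Lemma dual_act1 f : dual_act 1%g f = f.
Proof. by apply/val_inj/funext => v /=; rewrite invg1 rep_act1. Qed.
Lemma dual_actM g h f : dual_act (g * h)%g f = dual_act g (dual_act h f).
Proof. by apply/val_inj/funext => v /=; rewrite invgM rep_actM. Qed.
Definition dual_rep : rep G R := Rep dual_act_linear dual_act1 dual_actM.
End Dual.
End Representations.

(* V^{\otimes X}, with tensor factors indexed by X: the free module on the
   functions X -> B, where B indexes a basis of V.  The value of a tensor at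
   t is its coefficient on t. *)
Definition tensor (R : comPzRingType) (B X : finType) : lmodType R :=
  {ffun {ffun X -> B} -> R^o}.

Section Tensor.
Variables (G : groupType) (R : comPzRingType) (V : rep G R).
Variables (B : finType) (b : basis B V).

Definition tens (X : finType) (t : {ffun X -> B}) : tensor R B X :=
  [ffun u => (u == t)%:R].

(* The pure tensor with factor v x in position x. *)
Definition pure_tensor (X : finType) (v : X -> V) : tensor R B X :=
  [ffun t : {ffun X -> B} => \prod_x bcoord b (t x) (v x)].

(* The diagonal action. *)
Definition tensor_act (X : finType) (g : G) (x : tensor R B X) : tensor R B X :=
  \sum_t x t *: pure_tensor (fun p => rep_act g (b (t p))).

Section TensorTheory.
Variable X : finType.
Implicit Types (x : tensor R B X) (t u : {ffun X -> B}).

Lemma tensor_sumE x : x = \sum_t x t *: tens t.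
Proof.
apply/ffunP => u; rewrite sum_ffunE (bigD1 u) //= !ffunE eqxx.
rewrite [_ *: _]mulr1 big1 ?addr0 // => t /negPf tu.
by rewrite !ffunE eq_sym tu [LHS]mulr0.
Qed.

Lemma pure_tensor_basis t : pure_tensor (fun p => b (t p)) = tens t.
Proof.
apply/ffunP => u; rewrite !ffunE.
have [->|/eqP ut] := eqVneq u t.
  by rewrite big1 // => p _; rewrite bcoord_basis eqxx.
have [p up] : exists p, u p != t p.
  apply/existsP; rewrite -negb_forall; apply/negP => /forallP h.
  by apply: ut; apply/ffunP => p; apply/eqP.
by rewrite (bigD1 p) //= bcoord_basis (negPf up) mul0r.
Qed.

Lemma tensor_act_linear g : linear (@tensor_act X g).
Proof.
move=> a x y; rewrite /tensor_act scaler_sumr -big_split /=.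
by apply: eq_bigr => t _; rewrite !ffunE scalerDl scalerA.
Qed.
HB.instance Definition _ g :=
  GRing.isLinear.Build R (tensor R B X) (tensor R B X) *:%R (@tensor_act X g)
    (tensor_act_linear g).

Lemma tensor_act_pure g (v : X -> V) :
  tensor_act g (pure_tensor v) = pure_tensor (fun p => rep_act g (v p)).
Proof.
apply/ffunP => u; rewrite /tensor_act sum_ffunE ffunE.
under [RHS]eq_bigr => p _ do
  rewrite {1}[v p](bcoordK b) !linear_sum.
rewrite bigA_distr_bigA /=; apply: eq_bigr => t _.
rewrite !ffunE -[LHS]/(_ * _) -big_split /=.
by apply: eq_bigr => p _; rewrite !linearZ.
Qed.

Lemma tensor_act1 x : tensor_act 1%g x = x.
Proof.
rewrite [RHS]tensor_sumE; apply: eq_bigr => t _; congr (_ *: _).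
by rewrite -pure_tensor_basis; apply/ffunP => u; rewrite !ffunE; under eq_bigr do rewrite rep_act1.
Qed.

Lemma tensor_actM g h x :
  tensor_act (g * h)%g x = tensor_act g (tensor_act h x).
Proof.
rewrite [tensor_act h x]/tensor_act linear_sum; apply: eq_bigr => t _.
rewrite linearZ /= tensor_act_pure; congr (_ *: _).
by apply/ffunP => u; rewrite !ffunE; under eq_bigr do rewrite rep_actM.
Qed.

Definition tensor_rep : rep G R :=
  Rep tensor_act_linear tensor_act1 tensor_actM.
End TensorTheory.
End Tensor.

Definition is_partition (n : nat) (la : seq nat) :=
  [&& sorted geq la, 0%N \notin la & sumn la == n].

Section Boxes.
Variable la : seq nat.

(* The Young diagram; rows and columns are numbered from 0. *)
Definition box : finType := {i : 'I_(size la) & 'I_(nth 0%N la i)}.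
Definition mkbox (i : 'I_(size la)) (j : 'I_(nth 0%N la i)) : box :=
  Tagged (fun i : 'I_(size la) => 'I_(nth 0%N la i)) j.
Definition row (p : box) : 'I_(size la) := tag p.
Definition col (p : box) : nat := tagged p.

Definition row_boxes (i : 'I_(size la)) : {set box} := [set p | row p == i].

Definition RPP : {set {perm box}} := 
  [set s : {perm box} | [forall p, row (s p) == row p]].
Definition CPP : {set {perm box}} := 
  [set s : {perm box} | [forall p, col (s p) == col p]].

Variable B : finType.

Definition tableau : finType := {ffun box -> B}.

Definition row_equiv (t u : tableau) :=
  [forall i, perm_eq [seq t p | p in row_boxes i] [seq u p | p in row_boxes i]].
End Boxes.

(* The right action of place permutations, (t . s)(p) = t (p s^-1). *)
Definition place (X B : finType) (t : {ffun X -> B}) (s : {perm X}) :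
  {ffun X -> B} := [ffun p => t (s^-1%g p)].

Definition rstab (la : seq nat) (B : finType) (t : tableau la B) :
  {set {perm box la}} := [set s in RPP la | place t s == t].

Section Place.
Variables X B : finType.
Implicit Types (t u : {ffun X -> B}) (s r : {perm X}).

Lemma place1 t : place t 1%g = t.
Proof. by apply/ffunP => p; rewrite ffunE invg1 perm1. Qed.

Lemma placeM t s r : place t (s * r)%g = place (place t s) r.
Proof. by apply/ffunP => p; rewrite !ffunE invMg permM. Qed.

Lemma placeK s : cancel (fun t => place t s) (fun t => place t s^-1%g).
Proof. by move=> t; rewrite -placeM mulgV place1. Qed.
End Place.

Section RowGroups.
Variables (la : seq nat) (B : finType).
Implicit Types (t u w : tableau la B) (s r : {perm box la}).

Lemma RPP_group_set : group_set (RPP la).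
Proof.
apply/group_setP; split=> [|s r]; first by rewrite inE; apply/forallP => p; rewrite perm1.
rewrite !inE => /forallP sP /forallP rP; apply/forallP => p.
by rewrite permM (eqP (rP _)) (eqP (sP _)).
Qed.
Canonical RPP_group := Group RPP_group_set.

Lemma rstab_group_set t : group_set (rstab t).
Proof.
apply/group_setP; split=> [|s r]; first by rewrite inE group1 place1 /=.
rewrite !inE => /andP[sP /eqP st] /andP[rP /eqP rt].
have := @groupM _ RPP_group s r; rewrite !inE => -> //.
by rewrite placeM st rt /=.
Qed.
Canonical rstab_group t := Group (rstab_group_set t).

Lemma rstab_sub t : rstab t \subset RPP la.
Proof. by apply/subsetP => s; rewrite inE => /andP[]. Qed.

Lemma place_coset t s r : s \in RPP la -> r \in RPP la ->
  (place t s == place t r) = ((rstab t :* s) == (rstab t :* r))%g.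
Proof.
move=> sP rP; rewrite (sameP eqP (@rcoset_eqP _ (rstab_group t) s r)).
rewrite mem_rcoset inE groupM ?groupV //= placeM.
apply/eqP/eqP => [->|e]; first by rewrite -placeM mulgV place1.
by apply: (can_inj (placeK r^-1%g)); rewrite e -placeM mulgV place1.
Qed.

(* Sums over coset representatives are sums over the distinct tableaux that are
   row equivalent to t. *)
Lemma rcosets_sum (M : nmodType) t (F : tableau la B -> M) :
  \sum_(C in rcosets (rstab t) (RPP la)) F (place t (repr C)) =
  \sum_(u in [set place t s | s in RPP la]) F u.
Proof.
have reprP C : C \in rcosets (rstab t) (RPP la) ->
    repr C \in RPP la /\ C = (rstab t :* repr C)%g.
  move=> /rcosetsP[s sP ->]; have := mem_repr_rcoset (rstab_group t) s.
  move=> /rcosetP[r rt ->]; split.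
    by rewrite (groupM (G := RPP_group)) // (subsetP (rstab_sub t)).
  by rewrite rcosetM (@rcoset_id _ (rstab_group t) _ rt).
pose h C := place t (repr C).
have -> : [set place t s | s in RPP la] = h @: rcosets (rstab t) (RPP la).
  apply/setP => u; apply/imsetP/imsetP => [[s sP ->]|[C CP ->]]; last first.
    by exists (repr C) => //; case: (reprP C CP).
  have CP : (rstab t :* s)%g \in rcosets (rstab t) (RPP la).
    by apply/rcosetsP; exists s.
  exists (rstab t :* s)%g => //; have [rP e] := reprP _ CP.
  by apply/eqP; rewrite /h place_coset // -e.
rewrite [RHS]big_imset //= => C D CP DP /eqP.
have [cP {2}->] := reprP _ CP; have [dP {2}->] := reprP _ DP.
by rewrite /h place_coset // => /eqP.
Qed.
End RowGroups.

Section Young.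
Variables (G : groupType) (R : comPzRingType) (V : rep G R).
Variables (B : finType) (b : basis B V) (la : seq nat).
Local Notation T := (tableau la B).
Local Notation tensors := (tensor_rep b (box la)).
Local Notation pure v := (pure_tensor b v : tensors).
Implicit Types (t u w : T) (s : {perm box la}).

(* Sym^la V and \bigwedge^la' V are tensor products, over the rows resp. the
   columns, of quotients of tensor powers of V.  They are obtained here directly
   as quotients of V^{\otimes n}, by the submodules spanned by the defining
   relations of each factor tensored with arbitrary vectors elsewhere. *)
Definition sym_relation (x : tensors) :=
  exists (v : box la -> V) s,
    s \in RPP la /\ x = pure v - pure (fun p => v (s^-1%g p)).

Lemma sym_relation_stable : stable (Rspan sym_relation).
Proof.
apply: Rspan_stable => g _ [v [s [sP ->]]]; apply: mem_Rspan.
by exists (fun p => rep_act g (v p)), s; rewrite linearB /= !tensor_act_pure.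
Qed.

(* Sym^la V, and the class [t] of a tableau in it. *)
Definition Sym_up : rep G R := quot_rep sym_relation_stable.

Definition sym_class (t : T) : Sym_up := qproj _ (tens R t).

Definition ext_relation (x : tensors) :=
  exists (v : box la -> V) p q,
    [/\ p != q, col p = col q, v p = v q & x = pure v].

Lemma ext_relation_stable : stable (Rspan ext_relation).
Proof.
apply: Rspan_stable => g _ [v [p [q [pq cpq vpq ->]]]]; apply: mem_Rspan.
exists (fun p => rep_act g (v p)), p, q; rewrite -vpq; split=> //.
exact: tensor_act_pure.
Qed.

(* \bigwedge^la' V, and the class |t| of a tableau in it. *)
Definition Ext : rep G R := quot_rep ext_relation_stable.

Definition wedge (t : T) : Ext := qproj _ (tens R t).

Definition polytabloid (t : T) : Sym_up :=
  \sum_(s in CPP la) (-1) ^+ odd_perm s *: sym_class (place t s).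

Definition copolytabloid (t : T) : Ext :=
  \sum_(C in rcosets (rstab t) (RPP la)) wedge (place t (repr C)).

Definition polytab : {pred Sym_up} :=
  Rspan (fun x => exists t, x = polytabloid t).
HB.instance Definition _ := GRing.SubmodClosed.on polytab.

Definition copolytab : {pred Ext} :=
  Rspan (fun x => exists t, x = copolytabloid t).
HB.instance Definition _ := GRing.SubmodClosed.on copolytab.

Lemma pure_place (v : box la -> V) s :
  pure (fun p => v (s^-1%g p)) = \sum_t pure_tensor b v t *: tens R (place t s).
Proof.
rewrite [LHS]tensor_sumE (reindex (fun t => place t s)) /=; last first.
  exists (fun t => place t s^-1%g) => t _; first exact: placeK.
  by rewrite -placeM mulVg place1.
apply: eq_bigr => t _; congr (_ *: _); rewrite !ffunE.
rewrite (reindex_inj (@perm_inj _ s)) /=.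
by apply: eq_bigr => p _; rewrite ffunE permK.
Qed.

Lemma polytab_stable : stable polytab.
Proof.
apply: Rspan_stable => g _ [t ->].
have -> : rep_act g (polytabloid t) =
    \sum_u pure_tensor b (fun p => rep_act g (b (t p))) u *: polytabloid u.
  rewrite /polytabloid rep_act_sum; under [RHS]eq_bigr do rewrite scaler_sumr.
  rewrite exchange_big; apply: eq_bigr => s _.
  rewrite rep_actZ; have -> : rep_act g (sym_class (place t s)) =
      qproj (Rspan sym_relation) (tensor_act b g (tens R (place t s))).
    exact: (quot_actE sym_relation_stable).
  rewrite -(pure_tensor_basis b) tensor_act_pure.
  have -> : pure_tensor b (fun p => rep_act g (b (place t s p))) =
      pure_tensor b (fun p => rep_act g (b (t (s^-1%g p)))).
    by apply/ffunP => u; rewrite !ffunE; under eq_bigr do rewrite ffunE.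
  rewrite (pure_place (fun p => rep_act g (b (t p)))) linear_sum scaler_sumr.
  by apply: eq_bigr => u _; rewrite linearZ !scalerA mulrC.
by apply: rpred_sum => u _; apply: rpredZ; apply: mem_Rspan; exists u.
Qed.

(* Sym_r V inside V^{\otimes r}. *)
Definition symmetric_tensor (X : finType) (x : tensor R B X) :=
  forall (s : {perm X}) (t : {ffun X -> B}), x (place t s) = x t.

(* The tensor product of tensors x i in V^{\otimes la_i}, with x i in the boxes
   of row i. *)
Definition row_tensor
    (x : forall i : 'I_(size la), tensor R B 'I_(nth 0%N la i)) : tensors :=
  [ffun t : T => \prod_i x i [ffun j => t (mkbox j)]].

(* Sym_la V. *)
Definition Sym_low : {pred tensors} := Rspan (fun y =>
  exists2 x : (forall i : 'I_(size la), tensor R B 'I_(nth 0%N la i)),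
    (forall i, symmetric_tensor (x i)) & y = row_tensor x).
HB.instance Definition _ := GRing.SubmodClosed.on Sym_low.

Definition rsym_tensor (t : T) : tensors :=
  \sum_(C in rcosets (rstab t) (RPP la)) tens R (place t (repr C)).

Lemma rsym_tensorE t w : rsym_tensor t w = (w \in [set place t s | s in RPP la])%:R.
Proof.
rewrite /rsym_tensor rcosets_sum sum_ffunE.
case: (boolP (w \in _)) => wt.
  rewrite (bigD1 w) //= !ffunE eqxx big1 ?addr0 // => u /andP[_ /negPf uw].
  by rewrite ffunE eq_sym uw.
rewrite big1 // => u ut; rewrite ffunE; case: eqP => // wu.
by rewrite wu ut in wt.
Qed.

Lemma RPP_rowP s : s \in RPP la ->
  exists r : (forall i : 'I_(size la), {perm 'I_(nth 0%N la i)}),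
    forall (i : 'I_(size la)) (j : 'I_(nth 0%N la i)), s (mkbox j) = mkbox (r i j).
Proof.
rewrite inE => /forallP sP.
have h (i : 'I_(size la)) (j : 'I_(nth 0%N la i)) : {k : 'I_(nth 0%N la i) | s (mkbox j) = mkbox k}.
  have /eqP := sP (mkbox j); rewrite {1}/row {1}/row /=.
  by case: (s _) => i' k /= e; subst i'; exists k.
have inj (i : 'I_(size la)) : injective (fun j => projT1 (h i j)).
  move=> j k; case: (h i j) (h i k) => j' /= ej [k' /= ek] jk.
  have /perm_inj/eqP := etrans ej (etrans (congr1 (fun l => mkbox l) jk) (esym ek)).
  by rewrite eq_Tagged /= => /eqP.
by exists (fun i => perm (inj i)) => i j; rewrite permE; case: (h i j).
Qed.

Lemma row_RPP (r : forall i : 'I_(size la), {perm 'I_(nth 0%N la i)}) :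
  exists2 s, s \in RPP la & forall (i : 'I_(size la)) (j : 'I_(nth 0%N la i)), s (mkbox j) = mkbox (r i j).
Proof.
pose f (p : box la) : box la := mkbox (r (tag p) (tagged p)).
have fI : injective f.
  move=> [i j] [i' j'] /eqP; rewrite /f /= -tag_eqE /tag_eq /=.
  move=> /andP[/eqP e]; subst i'; rewrite tagged_asE => /eqP/perm_inj -> //.
exists (perm fI) => [|i j]; last by rewrite permE.
by rewrite inE; apply/forallP => p; rewrite permE.
Qed.

Lemma Sym_low_inv x : x \in Sym_low ->
  forall s, s \in RPP la -> forall t, x (place t s) = x t.
Proof.
move=> /RspanP[l lP ->] s sP t; rewrite !sum_ffunE !big_seq; apply: eq_bigr => p pl.
rewrite !ffunE; have [y yS ->] := lP p pl; congr (_ * _); rewrite !ffunE.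
have [r rE] := RPP_rowP (groupVr (G := RPP_group la) sP).
apply: eq_bigr => i _; rewrite -[RHS](yS i (r i)^-1%g); congr (y i _).
by apply/ffunP => j; rewrite !ffunE rE invgK.
Qed.

Lemma rsym_subproof t : rsym_tensor t \in Sym_low.
Proof.
pose tr (w : T) (i : 'I_(size la)) : {ffun 'I_(nth 0%N la i) -> B} := [ffun j => w (mkbox j)].
apply: mem_Rspan.
exists (fun i => [ffun f => (f \in [set place (tr t i) r | r in [set: {perm _}]])%:R]).
  move=> i s f; rewrite !ffunE; congr (_%:R); congr nat_of_bool.
  apply/imsetP/imsetP => -[r _ e]; last by exists (r * s)%g; rewrite ?inE // placeM -e.
  by exists (r * s^-1)%g; rewrite ?inE // placeM -e placeK.
apply/ffunP => w; rewrite rsym_tensorE !ffunE.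
under eq_bigr do rewrite ffunE.
have -> : (w \in [set place t s | s in RPP la]) =
    [forall i, tr w i \in [set place (tr t i) r | r in [set: {perm _}]]].
  apply/imsetP/forallP => [[s sP ->] i|h].
    have [r rE] := RPP_rowP (groupVr (G := RPP_group la) sP).
    apply/imsetP; exists (r i)^-1%g; first by rewrite inE.
    by apply/ffunP => j; rewrite !ffunE rE invgK.
  have {}h i : {r | tr w i = place (tr t i) r}.
    by apply: cid; have /imsetP[r _ e] := h i; exists r.
  have [s sP sE] := row_RPP (fun i => (projT1 (h i))^-1%g).
  exists s^-1%g; first exact: (groupVr (G := RPP_group la)).
  apply/ffunP => -[i j]; rewrite ffunE invgK sE; case: (h i) => r /= e.
  by have /ffunP/(_ j) := e; rewrite !ffunE.
case: (boolP [forall i, _]) => [/forallP h|].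
  by rewrite big1 // => i _; rewrite h.
rewrite negb_forall => /existsP[i /negPf hi].
by rewrite (bigD1 i) //= hi mul0r.
Qed.

Lemma inv_rsym (x : tensors) :
  (forall s, s \in RPP la -> forall t, x (place t s) = x t) ->
  x \in Rspan (fun y => exists t, y = rsym_tensor t).
Proof.
move=> xI; pose orb t : {set T} := [set place t s | s in RPP la].
have orbE t u : (orb u == orb t) = (u \in orb t).
  apply/eqP/idP => [<-|/imsetP[s sP ->]].
    by apply/imsetP; exists 1%g; rewrite ?place1 // (group1 (RPP_group la)).
  apply/setP => w; apply/imsetP/imsetP => -[r rP ->].
    by exists (s * r)%g; rewrite ?placeM // (groupM (G := RPP_group la)).
  exists (s^-1 * r)%g; last by rewrite -placeM mulKVg.
  by rewrite (groupM (G := RPP_group la)) // (groupVr (G := RPP_group la)).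
rewrite [x]tensor_sumE (partition_big orb (mem (orb @: [set: T]))) /=; last first.
  by move=> t _; apply: imset_f; rewrite inE.
apply: rpred_sum => _ /imsetP[t _ ->].
have -> : \sum_(u | orb u == orb t) x u *: tens R u = x t *: rsym_tensor t.
  rewrite /rsym_tensor rcosets_sum scaler_sumr.
  apply: eq_big => [u|u]; rewrite orbE // => /imsetP[s sP ->].
  by rewrite xI.
by apply: rpredZ; apply: mem_Rspan; exists t.
Qed.

Lemma tensor_act_inv g (x : tensors) :
  (forall s, s \in RPP la -> forall t, x (place t s) = x t) ->
  forall s, s \in RPP la -> forall t, rep_act g x (place t s) = rep_act g x t.
Proof.
move=> xI s sP t; rewrite /= /tensor_act !sum_ffunE.
rewrite (reindex (fun u : T => place u s)) /=; last first.
  exists (fun u => place u s^-1%g) => u _; first exact: placeK.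
  by rewrite -placeM mulVg place1.
apply: eq_bigr => u _; rewrite !ffunE xI //; congr (_ * _).
rewrite (reindex_inj (@perm_inj _ s)) /=.
by apply: eq_bigr => p _; rewrite !ffunE permK.
Qed.

Lemma Sym_low_stable : stable Sym_low.
Proof.
move=> g x xS; have /(tensor_act_inv g)/inv_rsym := Sym_low_inv xS.
by apply: Rspan_ind => _ [t ->]; exact: rsym_subproof.
Qed.

Definition Sym_low_rep : rep G R := sub_rep Sym_low_stable.

Lemma copolytabloidE t : copolytabloid t = qproj _ (rsym_tensor t).
Proof. by rewrite /rsym_tensor linear_sum. Qed.

Lemma copolytab_stable : stable copolytab.
Proof.
apply: Rspan_stable => g _ [t ->]; rewrite copolytabloidE [rep_act _ _](quot_actE ext_relation_stable).
have /(tensor_act_inv g)/inv_rsym/RspanP[l lP ->] := Sym_low_inv (rsym_subproof t).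
rewrite linear_sum big_seq; apply: rpred_sum => p pl.
rewrite linearZ; apply: rpredZ; apply: mem_Rspan.
by have [u ->] := lP p pl; exists u; rewrite copolytabloidE.
Qed.

Definition polytab_rep : rep G R := sub_rep polytab_stable.
Definition copolytab_rep : rep G R := sub_rep copolytab_stable.

Definition rsym (t : T) : Sym_low_rep :=
  @exist _ (fun x => x \in Sym_low) _ (rsym_subproof t).

(* TT is the orbit of t under S_{A \sqcup A'}, as a set of tableaux; u runs over
   representatives of its row equivalence classes. *)
Definition dual_garnir (t : T) (A A' : {set box la}) : Sym_low_rep :=
  let TT := [set place t s | s in Sym (A :|: A')] in
  \sum_(u in transversal (equivalence_partition (@row_equiv la B) TT) TT)
    rsym u *+ #|rstab u : rstab u :&: (Sym (A :|: A') * Sym (~: (A :|: A')))%g|%g.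

(* Only the R-module structure of DG is built here: its stability under G is not
   needed to define it. *)
Definition DG : {pred Sym_low_rep} := Rspan (fun x =>
  exists (t : T) (i k : 'I_(size la)) (A A' : {set box la}),
    [/\ (i < k)%N, A \subset row_boxes i, A' \subset row_boxes k,
        (nth 0%N la i < #|A| + #|A'|)%N & x = dual_garnir t A A']).
HB.instance Definition _ := GRing.SubmodClosed.on DG.

End Young.
Arguments DG {G R V B} b la _.
Arguments polytab {G R V B} b la _.
Arguments copolytab {G R V B} b la _.

(* \nabla^la V and \Delta^la V = (\nabla^la (V^* ))^*, the basis of V^* being the
   one dual to b. *)
Definition Schur G R (V : rep G R) (B : finType) (b : basis B V) (la : seq nat) :
  rep G R := polytab_rep b la.

Definition Weyl G R (V : rep G R) (B : finType) (b : basis B V) (la : seq nat) :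
  rep G R := dual_rep (@Schur G R (dual_rep V) B (dual_basis b) la).

(* Main.v *)
(* Let Alt(x)(t) be the signed sum of the coefficients of x over the column
   permutations of t.  Sym_la(V) maps onto copolytab(V), by projection to the
   exterior powers, and to the Weyl module, by pairing row-symmetric tensors with
   polytabloids of V^*; the value of x on e(t) is Alt(x)(t).  Both maps are
   surjective with kernel DG:
   - DG lies in the kernel of the projection, since a dual Garnir relation is a
     sum of indicator functions of sets of tableaux, each closed under swapping
     two boxes of a common column; and Alt vanishes on that kernel;
   - modulo DG every rsym(t) is a combination of semistandard ones, by induction
     on the weight, the sum over the boxes of row index times entry;
   - the matrix Alt(rsym(u))(t), for t and u semistandard, is unitriangular with
     respect to the weight, so Alt(x) = 0 forces x into DG.
   Surjectivity onto the Weyl module needs no straightening of polytabloids: by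
   unitriangularity and the second point, e(t) minus a suitable combination of
   semistandard polytabloids pairs to zero with all of Sym_la(V), which is in
   perfect duality with Sym^la(V^* ). *)
From HB Require Import structures.
Require Import Defs.
From mathcomp Require Import all_boot all_order all_algebra.
From mathcomp Require Import all_fingroup zify boolp functions.
Import Defs.

Set Implicit Arguments.
Unset Strict Implicit.
Unset Printing Implicit Defensive.
Import GRing.Theory.
Local Open Scope ring_scope.

(** * Surjections with a common kernel, unitriangular systems, fibres, rearrangement *)

(** Both targets are the quotient of [U] by the common kernel: lift along [f1], then apply [f2].
    Equality of the kernels makes the result independent of the lift, which yields linearity, the
    inverse and equivariance. *)
Lemma rep_iso_coker (G : groupType) (R : comPzRingType) (U W1 W2 : rep G R)
    (f1 : {linear U -> W1}) (f2 : {linear U -> W2}) :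
  (forall g u, f1 (rep_act g u) = rep_act g (f1 u)) ->
  (forall g u, f2 (rep_act g u) = rep_act g (f2 u)) ->
  (forall y, exists x, f1 x = y) -> (forall y, exists x, f2 x = y) ->
  (forall x, f1 x = 0 <-> f2 x = 0) -> rep_iso W1 W2.
Proof.
move=> f1G f2G s1 s2 k12.
pose r1 y := projT1 (cid (s1 y)); pose r2 y := projT1 (cid (s2 y)).
have r1K y : f1 (r1 y) = y by rewrite /r1; case: cid.
have r2K y : f2 (r2 y) = y by rewrite /r2; case: cid.
have F1 x : f2 (r1 (f1 x)) = f2 x.
  by apply/subr0_eq; rewrite -linearB; apply/k12; rewrite linearB r1K subrr.
have F2 x : f1 (r2 (f2 x)) = f1 x.
  by apply/subr0_eq; rewrite -linearB; apply/k12; rewrite linearB r2K subrr.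
pose h y := f2 (r1 y).
have hl : linear h.
  by move=> a x y; rewrite /h -[in LHS](r1K x) -[in LHS](r1K y) -linearP F1 linearP.
pose hL : {linear W1 -> W2} :=
  HB.pack h (GRing.isLinear.Build R W1 W2 *:%R h hl).
exists hL; split.
  exists (fun y => f1 (r2 y)) => y; first by rewrite [hL y]/(h y) /h F2 r1K.
  by rewrite [hL _]/(h _) /h F1 r2K.
move=> g y; rewrite ![hL _]/(h _) /h.
by rewrite -[in LHS](r1K y) -f1G F1 f2G.
Qed.

(* Jacobi iteration stabilises, one level of r at a time. *)
Lemma unitriangular_solve (R : pzRingType) (I : finType) (P : pred I)
    (N : I -> I -> R) (r : I -> nat) (c : I -> R) :
  (forall i, P i -> N i i = 1) ->
  (forall i j, P i -> P j -> i != j -> (r i <= r j)%N -> N i j = 0) ->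
  exists a : I -> R, forall i, P i -> \sum_(j | P j) N i j * a j = c i.
Proof.
move=> N1 N0.
pose E (a : I -> R) i := c i - \sum_(j | P j && (j != i)) N i j * a j.
pose a m := iter m E (fun=> 0).
have aE m : forall i, P i -> (r i < m)%N -> a m.+1 i = a m i.
  elim: m => // m IH i Pi im.
  rewrite [LHS]/(E (a m.+1) i) [RHS]/(E (a m) i); congr (_ - _).
  apply: eq_bigr => j /andP[Pj ji].
  have [rij|rji] := leqP (r i) (r j); first by rewrite N0 ?mul0r // eq_sym.
  by rewrite IH //; apply: leq_trans rji _.
have [M rM] : exists M, forall i, (r i < M)%N.
  by exists (\max_i r i).+1 => i; rewrite ltnS leq_bigmax.
(* After [M] rounds every coordinate in [P] is stationary, and a fixed point of [E] on [P] solves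
   the system. *)
exists (a M) => i Pi; rewrite (bigD1 i) //= N1 // mul1r -aE //.
by rewrite [a M.+1 i]/(E (a M) i) /E subrK.
Qed.

(** List the fibres of [F] and of [H] over each value and match them position by position. *)
Lemma perm_of_fibers (X : finType) (Y : eqType) (F H : X -> Y) :
  (forall y, #|[set p | F p == y]| = #|[set p | H p == y]|) ->
  exists s : {perm X}, forall p, H (s p) = F p.
Proof.
move=> FH.
pose eF y := enum [set p | F p == y]; pose eH y := enum [set p | H p == y].
have sz y : size (eF y) = size (eH y) by rewrite -!cardE.
pose s p := nth p (eH (F p)) (index p (eF (F p))).
have pF p : p \in eF (F p) by rewrite mem_enum inE.
have ix p : (index p (eF (F p)) < size (eH (F p)))%N by rewrite -sz index_mem.
have sH p : H (s p) = F p.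
  by have := mem_nth p (ix p); rewrite mem_enum inE => /eqP.
have sI : injective s.
  move=> p q e; have Fpq : F p = F q by rewrite -!sH e.
  move: e (ix p) (ix q); rewrite /s -Fpq => e ip iq.
  (* The two [nth] carry different defaults, [p] and [q]; both indices are in range, so the defaults
     can be made equal. *)
  have /eqP := e; rewrite (set_nth_default q p ip) nth_uniq ?enum_uniq // => /eqP ipq.
  by rewrite -(nth_index q (pF p)) ipq Fpq nth_index.
by exists (perm sI) => p; rewrite permE.
Qed.

(** Rearrangement inequality: the exchange raises the sum by [(f q - f p) * (g p - g q)]. *)
Lemma swap_sum (X : finType) (f g : X -> nat) (p q : X) :
  (f p < f q)%N -> (g q < g p)%N ->
  (\sum_x f x * g x < \sum_x f x * g (tperm p q x))%N.
Proof.
move=> fpq gpq.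
have qp : q != p by apply: contraTneq fpq => ->; rewrite ltnn.
rewrite (bigD1 p) //= (bigD1 q) //= [X in (_ < X)%N](bigD1 p) //=.
rewrite [X in (_ < _ + X)%N](bigD1 q) //= tpermL tpermR !addnA.
have -> : (\sum_(i | (i != p) && (i != q)) f i * g (tperm p q i) =
   \sum_(i | (i != p) && (i != q)) f i * g i)%N.
  by apply: eq_bigr => i /andP[ip iq]; rewrite tpermD // eq_sym.
by rewrite ltn_add2r; nia.
Qed.

(** * Boxes and tableaux *)

Section Diagram.
Variable la : seq nat.
Implicit Types (p q : box la) (s : {perm box la}).

Lemma box_eq p q : row p = row q -> col p = col q -> p = q.
Proof.
case: p q => i j [i' j']; rewrite /row /col /= => e; subst i'.
by move=> /ord_inj ->.
Qed.

Lemma col_lt p : (col p < nth 0%N la (row p))%N.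
Proof. exact: ltn_ord. Qed.

Lemma card_row_boxes (i : 'I_(size la)) (P : pred nat) :
  #|[set p : box la | (row p == i) && P (col p)]| =
  #|[set j : 'I_(nth 0%N la i) | P j]|.
Proof.
rewrite -(card_imset (mem [set j : 'I_(nth 0%N la i) | P j]) (f := @mkbox la i)).
  apply: eq_card => p; rewrite inE; apply/andP/imsetP => [[/eqP]|[j]].
    case: p => i' j; rewrite /row /= => e; subst i' => Pj.
    by exists j; rewrite // inE.
  by rewrite inE => Pj ->; rewrite /row /= eqxx.
by move=> j j' /(congr1 (@col la)) /ord_inj.
Qed.

Lemma card_row_ge (i : 'I_(size la)) j : (j <= nth 0%N la i)%N ->
  #|[set p : box la | (row p == i) && (j <= col p)%N]| = (nth 0%N la i - j)%N.
Proof.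
move=> ji; rewrite (card_row_boxes i (fun k => j <= k)%N) -sum1dep_card.
rewrite -(big_mkord (fun k => j <= k)%N (fun=> 1%N)) (@big_cat_nat _ _ _ j) //=.
rewrite big_nat_cond big_pred0 => [|k]; last by case: leqP; rewrite ?andbF.
by rewrite add0n big_nat_cond (eq_bigl (fun k => (j <= k < nth 0%N la i)%N)) =>
  [|k]; rewrite -?big_nat ?sum_nat_const_nat ?muln1 //; case: (j <= k)%N; rewrite ?andbT.
Qed.

Lemma card_row_le (i : 'I_(size la)) j : (j < nth 0%N la i)%N ->
  #|[set p : box la | (row p == i) && (col p <= j)%N]| = j.+1.
Proof.
move=> ji; rewrite (card_row_boxes i (fun k => k <= j)%N) -sum1dep_card.
rewrite -(big_mkord (fun k => k <= j)%N (fun=> 1%N)) (@big_cat_nat _ _ _ j.+1) //=.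
rewrite addnC big_nat_cond big_pred0 => [|k]; last first.
  by case: ltnP; rewrite ?andbF // andbT leqNgt => ->; rewrite andbF.
rewrite add0n big_nat_cond (eq_bigl (fun k => (0 <= k < j.+1)%N)) =>
  [|k]; rewrite -?big_nat ?sum_nat_const_nat ?muln1 // ltnS.
by case: (k <= j)%N.
Qed.

(** Pigeonhole: row [k] is no longer than row [i], so the columns of [A] and [A'] all lie among
    those of row [i], which are too few to keep them disjoint. *)
Lemma share_column (i k : 'I_(size la)) (A A' : {set box la}) :
  (nth 0%N la k <= nth 0%N la i)%N -> A \subset row_boxes i ->
  A' \subset row_boxes k -> (nth 0%N la i < #|A| + #|A'|)%N ->
  exists p q, [/\ p \in A, q \in A' & col p = col q].
Proof.
set m := nth 0%N la i => km Ai Ak mAA.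
(* [inord] asks for a nonempty ordinal, hence [m.+1]; the value [m] is never taken, so removing
   [ord_max] restores the bound [m]. *)
pose c p : 'I_m.+1 := inord (col p).
have colE (l : 'I_(size la)) (C : {set box la}) p : (nth 0%N la l <= m)%N ->
    C \subset row_boxes l -> p \in C -> row p = l /\ c p = col p :> nat.
  move=> lm Cl /(subsetP Cl); rewrite inE => /eqP rp; split=> //.
  by rewrite inordK // ltnS (leq_trans _ lm) // -rp ltnW // col_lt.
have cI (l : 'I_(size la)) (C : {set box la}) : (nth 0%N la l <= m)%N ->
    C \subset row_boxes l -> {in C &, injective c}.
  move=> lm Cl p q pC qC e.
  have [rp cp] := colE l C p lm Cl pC; have [rq cq] := colE l C q lm Cl qC.
  by apply: box_eq; [rewrite rp rq | rewrite -cp -cq e].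
have cm (l : 'I_(size la)) (C : {set box la}) : (nth 0%N la l <= m)%N ->
    C \subset row_boxes l -> c @: C \subset [set~ ord_max].
  move=> lm Cl; apply/subsetP => _ /imsetP[p pC ->].
  have [rp cp] := colE l C p lm Cl pC.
  by rewrite !inE -val_eqE /= cp neq_ltn (leq_trans (col_lt p)) // rp.
have : c @: A :&: c @: A' != set0.
  apply: contraTneq mAA => I0; rewrite -leqNgt.
  rewrite -(card_in_imset (cI i A (leqnn m) Ai)) -(card_in_imset (cI k A' km Ak)).
  rewrite -cardsUI I0 cards0 addn0.
  have cardm : #|[set~ (ord_max : 'I_m.+1)]| = m by rewrite cardsC1 card_ord.
  by rewrite -[leqRHS]cardm; apply: subset_leq_card; rewrite subUset (cm i) // (cm k).
case/set0Pn => _ /setIP[/imsetP[p pA ->] /imsetP[q qA e]].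
exists p, q; split=> //.
by have [_ <-] := colE i A p (leqnn m) Ai pA; have [_ <-] := colE k A' q km Ak qA; rewrite e.
Qed.

Lemma tperm_CPP p q : col p = col q -> tperm p q \in CPP la.
Proof.
move=> e; rewrite inE; apply/forallP => x.
by case: tpermP => [->|->|_ _] //; rewrite e.
Qed.

Lemma tperm_RPP p q : row p = row q -> tperm p q \in RPP la.
Proof.
move=> e; rewrite inE; apply/forallP => x.
by case: tpermP => [->|->|_ _] //; rewrite e.
Qed.

Lemma CPP_group_set : group_set (CPP la).
Proof.
apply/group_setP; split=> [|s r]; first by rewrite inE; apply/forallP => p; rewrite perm1.
rewrite !inE => /forallP sP /forallP rP; apply/forallP => p.
by rewrite permM (eqP (rP _)) (eqP (sP _)).
Qed.
Canonical CPP_group := Group CPP_group_set.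

Lemma CPP_col s p : s \in CPP la -> col (s p) = col p.
Proof. by rewrite inE => /forallP/(_ p)/eqP. Qed.

Lemma RPP_row s p : s \in RPP la -> row (s p) = row p.
Proof. by rewrite inE => /forallP/(_ p)/eqP. Qed.

(** Let [p] be a moved box whose row index is least. Its image and its preimage are moved boxes of
    the same column, hence lie in strictly later rows; the preimage serves as [q]. *)
Lemma CPP_inversion s : s \in CPP la -> s != 1%g ->
  exists p q, [/\ col p = col q, (row p < row q)%N & (row (s q) < row (s p))%N].
Proof.
move=> sC s1.
have [p0 sp0] : exists p, s p != p.
  apply/existsP; apply: contraNT s1; rewrite negb_exists => /forallP h.
  by apply/eqP/permP => p; rewrite perm1; apply/eqP; rewrite -[_ == _]negbK h.
case: (@arg_minnP _ p0 (fun p => s p != p) (fun p => val (row p)) sp0) => p sp pmin.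
have rowlt q : s q != q -> col q = col p -> q != p -> (row p < row q)%N.
  move=> sq cq qp; rewrite ltn_neqAle (pmin q sq) andbT; apply: contra qp.
  by move=> /eqP e; apply/eqP/box_eq; [apply: val_inj | ].
exists p, (s^-1 p)%g; rewrite permKV.
have sV : (s^-1 \in CPP la)%g by rewrite (groupVr (G := CPP_group)).
split; first by rewrite CPP_col.
  apply: rowlt; rewrite ?permKV ?CPP_col //.
    by apply: contra sp => /eqP e; rewrite {1}e permKV.
  by apply: contra sp => /eqP e; rewrite -{1}e permKV.
apply: rowlt; rewrite ?CPP_col //.
by rewrite (inj_eq perm_inj).
Qed.

End Diagram.

(** * Row equivalence, weight and semistandard tableaux *)

Section Tableaux.
Variables (la : seq nat) (B : finType).
Local Notation T := (tableau la B).
Implicit Types (t u w : T) (s : {perm box la}) (C : {set box la}).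

Lemma placeE t s p : place t s (s p) = t p.
Proof. by rewrite ffunE permK. Qed.

Lemma place_tperm t s p q x :
  place t (s * tperm p q)%g x = place t s (tperm p q x).
Proof. by rewrite placeM ffunE tpermV. Qed.

Lemma card_place_perm_on t s C (P : pred B) : s \in Sym C ->
  #|[set p in C | P (place t s p)]| = #|[set p in C | P (t p)]|.
Proof.
rewrite inE => sC; rewrite -[RHS](card_imset _ (@perm_inj _ s)).
apply: eq_card => p; rewrite inE; apply/andP/imsetP => [[pC Pp]|[q]].
  exists (s^-1 p)%g; rewrite ?permKV // inE -(placeE t s) permKV Pp andbT.
  by rewrite -(perm_closed _ sC) permKV.
by rewrite inE => /andP[qC Pq] ->; rewrite placeE (perm_closed _ sC).
Qed.

Lemma card_splitC C (P : pred (box la)) :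
  #|[set p | P p]| = (#|[set p in C | P p]| + #|[set p | (p \notin C) && P p]|)%N.
Proof.
rewrite -(cardsID C); congr (_ + _)%N; apply: eq_card => p; rewrite !inE //.
by rewrite andbC.
Qed.

Lemma row_equiv_card t u :
  reflect (forall i x, #|[set p | (row p == i) && (t p == x)]| =
                       #|[set p | (row p == i) && (u p == x)]|)
          (row_equiv t u).
Proof.
have cE w i x : count_mem x [seq w p | p in row_boxes i] =
    #|[set p | (row p == i) && (w p == x)]|.
  rewrite count_map -size_filter cardE; congr size; rewrite /enum_mem -filter_predI.
  by apply: eq_filter => p; rewrite !inE /= andbC.
apply: (iffP forallP) => h i; last first.
  by apply/allP => x _ /=; rewrite !cE h.
by move=> x; rewrite -!cE; apply/seq.permP.
Qed.

(** Agreement outside [C] makes the entry counts of each row equal inside and outside [C]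
    separately, so boxes can be matched by row, membership in [C] and entry at once. *)
Lemma row_equiv_stab t u C : row_equiv t u -> (forall p, p \notin C -> t p = u p) ->
  exists s, [/\ s \in RPP la, s @: C = C & u = place t s].
Proof.
move=> /row_equiv_card tu tuC.
have [|r rE] := @perm_of_fibers _ _ (fun p => (row p, p \in C, u p))
    (fun p => (row p, p \in C, t p)).
  move=> [[i d] x]; have outE :
      #|[set p | (p \notin C) && ((row p == i) && (u p == x))]| =
      #|[set p | (p \notin C) && ((row p == i) && (t p == x))]|.
    by apply: eq_card => p; rewrite !inE; case: (boolP (p \in C)) => //= /tuC ->.
  case: d.
    have := tu i x; rewrite (card_splitC C) (card_splitC C (fun p => _ && (u p == _))).
    rewrite outE => /addIn e; have eqC w : #|[set p | (row p, p \in C, w p) == (i, true, x)]| =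
        #|[set p in C | (row p == i) && (w p == x)]|.
      by apply: eq_card => p; rewrite !inE !xpair_eqE eqb_id andbCA andbA.
    by rewrite !eqC e.
  have eqC w : #|[set p | (row p, p \in C, w p) == (i, false, x)]| =
      #|[set p | (p \notin C) && ((row p == i) && (w p == x))]|.
    by apply: eq_card => p; rewrite !inE !xpair_eqE eqbF_neg andbCA andbA.
  by rewrite !eqC.
have rrow p : row (r p) = row p by have [] := rE p.
have rC p : (r p \in C) = (p \in C) by have [] := rE p.
have rt p : t (r p) = u p by have [] := rE p.
exists r^-1%g; split.
- by rewrite (groupVr (G := RPP_group la)) // inE; apply/forallP => p; rewrite rrow.
- apply/setP => p; apply/imsetP/idP => [[q qC ->]|pC].
    by rewrite -rC permKV.
  by exists (r p); rewrite ?rC // permK.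
- by apply/ffunP => p; rewrite ffunE invgK rt.
Qed.

Lemma row_equivP t u :
  reflect (exists2 s, s \in RPP la & u = place t s) (row_equiv t u).
Proof.
apply: (iffP idP) => [tu|[s sP ->]].
  have [|s [sP _ ->]] := @row_equiv_stab t u setT tu; last by exists s.
  by move=> p; rewrite inE.
apply/row_equiv_card => i x; rewrite -(card_imset _ (@perm_inj _ s)).
apply: eq_card => p; rewrite inE; apply/imsetP/andP => [[q]|[rp tp]].
  by rewrite inE => /andP[rq tq] ->; rewrite placeE RPP_row.
by exists (s^-1 p)%g; rewrite ?permKV // inE -(placeE t s) permKV tp andbT
  -(RPP_row _ sP) permKV.
Qed.

Lemma row_equiv_refl t : row_equiv t t.
Proof. by apply/row_equiv_card. Qed.

Lemma row_equiv_sym t u : row_equiv t u = row_equiv u t.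
Proof. by apply/row_equiv_card/row_equiv_card => h i x; rewrite h. Qed.

Lemma row_equiv_trans t u w : row_equiv t u -> row_equiv u w -> row_equiv t w.
Proof.
move=> /row_equiv_card tu /row_equiv_card uw; apply/row_equiv_card => i x.
by rewrite tu.
Qed.

Lemma row_orbitE t u : (u \in [set place t s | s in RPP la]) = row_equiv t u.
Proof. by apply/imsetP/row_equivP. Qed.

(* Any injective valuation would do: the theorem does not depend on the order. *)
Definition val_of (x : B) : nat := enum_rank x.

Lemma val_of_inj : injective val_of.
Proof. by move=> x y /val_inj /enum_rank_inj. Qed.

Definition weight t : nat := (\sum_p row p * val_of (t p))%N.

Lemma weight_row_equiv t u : row_equiv t u -> weight u = weight t.
Proof.
case/row_equivP => s sP ->; rewrite /weight (reindex_inj (@perm_inj _ s)) /=.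
by apply: eq_bigr => p _; rewrite placeE RPP_row.
Qed.

Definition row_sorted t := [forall p, forall q,
  (row p == row q) && (col p <= col q)%N ==> (val_of (t p) <= val_of (t q))%N].

Definition col_strict t := [forall p, forall q,
  (col p == col q) && (row p < row q)%N ==> (val_of (t p) < val_of (t q))%N].

Definition ssyt t := row_sorted t && col_strict t.

Lemma row_sortedP t : reflect (forall p q, row p = row q -> (col p <= col q)%N ->
  (val_of (t p) <= val_of (t q))%N) (row_sorted t).
Proof.
apply: (iffP 'forall_forallP) => h p q; last first.
  by apply/implyP => /andP[/eqP ? ?]; apply: h.
by move=> rpq cpq; apply: (implyP (h p q)); rewrite rpq eqxx.
Qed.

Lemma col_strictP t : reflect (forall p q, col p = col q -> (row p < row q)%N ->
  (val_of (t p) < val_of (t q))%N) (col_strict t).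
Proof.
apply: (iffP 'forall_forallP) => h p q; last first.
  by apply/implyP => /andP[/eqP ? ?]; apply: h.
by move=> rpq cpq; apply: (implyP (h p q)); rewrite rpq eqxx.
Qed.

(* A row permutation maximising the sum of column index times entry sorts the rows. *)
Lemma row_sorted_exists t : exists2 u, row_equiv t u & row_sorted u.
Proof.
pose F s := (\sum_p col p * val_of (place t s p))%N.
have R1 : (1 : {perm box la})%g \in RPP la by exact: (group1 (RPP_group la)).
case: (@arg_maxnP _ 1%g (mem (RPP la)) F R1) => s sR smax.
exists (place t s); first by apply/row_equivP; exists s.
apply/row_sortedP => p q rpq; rewrite leq_eqVlt => /predU1P[cpq|cpq].
  by rewrite (box_eq rpq cpq).
rewrite leqNgt; apply/negP => lt_qp.
have sR' : (s * tperm p q)%g \in RPP la.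
  by rewrite (groupM (G := RPP_group la)) // tperm_RPP.
have : (F (s * tperm p q)%g <= F s)%N := smax _ sR'; rewrite leqNgt => /negP[].
rewrite /F; under [X in (_ < X)%N]eq_bigr do rewrite place_tperm.
exact: swap_sum.
Qed.

(** If [t1 p < t2 p], count the entries of that row bounded by [t1 p]. In [t2] they sit strictly
    before [p], where [t1] obeys the bound too, and [p] itself counts only for [t1]; row equivalence
    forbids the difference. *)
Lemma row_sorted_uniq t u : row_sorted t -> row_sorted u -> row_equiv t u -> t = u.
Proof.
have le t1 t2 p : row_sorted t1 -> row_sorted t2 -> row_equiv t1 t2 ->
    (val_of (t2 p) <= val_of (t1 p))%N.
  move=> /row_sortedP st1 /row_sortedP st2 /row_equivP[s sR e].
  rewrite leqNgt; apply/negP => lt12.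
  pose low w := [set q | (row q == row p) && (val_of (w q) <= val_of (t1 p))%N].
  have : (#|low t1| <= #|low t2|)%N.
    rewrite -(card_imset (mem (low t1)) (@perm_inj _ s)); apply: subset_leq_card.
    by apply/subsetP => _ /imsetP[q + ->]; rewrite !inE e placeE RPP_row.
  apply/negP; rewrite -ltnNge; apply: proper_card; apply/properP; split.
    apply/subsetP => q; rewrite !inE => /andP[/eqP rq q2]; rewrite rq eqxx /=.
    apply: st1 => //; rewrite leqNgt; apply/negP => /ltnW cpq.
    have := leq_trans lt12 (st2 p q (esym rq) cpq); lia.
  by exists p; rewrite inE eqxx //= -ltnNge.
move=> st su tu; apply/ffunP => p; apply: val_of_inj; apply/eqP.
by rewrite eqn_leq !le // row_equiv_sym.
Qed.

(* A column permutation other than 1 has an inversion, and undoing it increases the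
   weight, so the maximum over the column group is attained at 1 only. *)
Lemma weight_CPP t s : col_strict t -> s \in CPP la -> s != 1%g ->
  (weight (place t s) < weight t)%N.
Proof.
move=> /col_strictP tC.
have incr r : r \in CPP la -> r != 1%g -> exists2 r', r' \in CPP la &
    (weight (place t r) < weight (place t r'))%N.
  move=> rC r1; have [p [q [cpq rpq rqp]]] := CPP_inversion rC r1.
  exists (r * tperm (r q) (r p))%g.
    by rewrite (groupM (G := CPP_group la)) // tperm_CPP // !CPP_col.
  rewrite /weight; under [X in (_ < X)%N]eq_bigr do rewrite place_tperm.
  by apply: swap_sum => //; rewrite !placeE tC.
have C1 : (1 : {perm box la})%g \in CPP la by exact: (group1 (CPP_group la)).
case: (@arg_maxnP _ 1%g (mem (CPP la)) (fun r => weight (place t r)) C1) => r rC rmax.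
have r1 : r = 1%g.
  apply/eqP; apply: contraT => /(incr r rC)[r' r'C].
  by rewrite ltnNge [(_ <= _)%N](rmax r' r'C).
move=> sC /(incr s sC)[s' s'C lt_ss'].
by apply: leq_trans lt_ss' _; rewrite -[leqRHS](congr1 weight (place1 t)) -r1; exact: rmax.
Qed.

(** * Exchanging large entries of one row with small entries of a later row *)

Section GarnirExchange.
Variables (t u : T) (i k : 'I_(size la)) (A A' : {set box la}) (c : nat).
Hypotheses (ik : (i < k)%N) (Ai : A \subset row_boxes i) (Ak : A' \subset row_boxes k).
Hypotheses (tA : {in A, forall p, c <= val_of (t p)}%N).
Hypotheses (tA' : {in A', forall p, val_of (t p) <= c}%N).
Variable s : {perm box la}.
Hypotheses (sC : s \in Sym (A :|: A')) (uE : u = place t s).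

Let dAA : [disjoint A & A'].
Proof.
rewrite disjoints_subset; apply/subsetP => p pA; rewrite inE; apply/negP => pA'.
move: (subsetP Ai _ pA) (subsetP Ak _ pA'); rewrite !inE => /eqP -> /eqP e.
by move: ik; rewrite e ltnn.
Qed.

Let sum_AA (f : box la -> nat) :
  (\sum_(p in A :|: A') f p = \sum_(p in A) f p + \sum_(p in A') f p)%N.
Proof.
rewrite (bigID (mem A)) /=; congr (_ + _)%N; apply: eq_bigl => p; rewrite !inE.
  by case: (p \in A); rewrite ?andbF.
case: (boolP (p \in A)) => pA /=; last by rewrite andbT.
by rewrite (disjointFr dAA pA).
Qed.

Let sum_place (f : B -> nat) :
  (\sum_(p in A :|: A') f (u p) = \sum_(p in A :|: A') f (t p))%N.
Proof.
rewrite (reindex_inj (@perm_inj _ s)) /=.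
by move: sC; rewrite inE => sC'; apply: eq_big => p; rewrite ?perm_closed // uE placeE.
Qed.

(** The total of the entries on [A :|: A'] is fixed, so the weight grows by [k - i] times the gain
    of [A']. That gain is the sum of all violations of the bounds by [u], so it is positive unless
    [u] obeys the same bounds as [t]. *)
Lemma garnir_weight : (weight t < weight u)%N \/
  {in A, forall p, c <= val_of (u p)}%N /\ {in A', forall p, val_of (u p) <= c}%N.
Proof.
have splitW w : weight w = (i * \sum_(p in A) val_of (w p) +
    k * \sum_(p in A') val_of (w p) +
    \sum_(p | p \notin A :|: A') row p * val_of (w p))%N.
  rewrite /weight (bigID (mem (A :|: A'))) /= sum_AA !big_distrr /=.
  congr (_ + _ + _)%N; apply: eq_bigr => p.
    by move=> /(subsetP Ai); rewrite inE => /eqP ->.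
  by move=> /(subsetP Ak); rewrite inE => /eqP ->.
have outE : (\sum_(p | p \notin A :|: A') row p * val_of (u p) =
    \sum_(p | p \notin A :|: A') row p * val_of (t p))%N.
  apply: eq_bigr => p pC; rewrite uE ffunE; move: (groupVr (G := [group of Sym (A :|: A')]) sC).
  by rewrite inE => /out_perm ->.
(* Truncated subtraction is intended: the deficits below [c] also have a fixed total, which for [t]
   comes from [A'] alone. *)
have := sum_place val_of; have := sum_place (fun x => c - val_of x)%N.
rewrite !sum_AA => H2 H1.
have H3 : (\sum_(p in A) (c - val_of (t p)) = 0)%N.
  by apply: big1 => p /tA; rewrite -subn_eq0 => /eqP.
have H4 : (\sum_(p in A') val_of (t p) + \sum_(p in A') (c - val_of (t p)) =
    \sum_(p in A') c)%N.
  by rewrite -big_split; apply: eq_bigr => p /tA' /= ?; rewrite subnKC.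
have H5 : (\sum_(p in A') val_of (u p) + \sum_(p in A') (c - val_of (u p)) =
    \sum_(p in A') c + \sum_(p in A') (val_of (u p) - c))%N.
  by rewrite -!big_split; apply: eq_bigr => p _ /=; lia.
rewrite !splitW outE.
have [/eqP|nz] := eqVneq (\sum_(p in A) (c - val_of (u p)) +
   \sum_(p in A') (val_of (u p) - c))%N 0%N; last by left; nia.
rewrite addn_eq0 !sum_nat_eq0 => /andP[/forall_inP z1 /forall_inP z2]; right.
by split=> p /[dup] pA; [move/z1|move/z2]; rewrite subn_eq0.
Qed.

(** Under the bounds, the entries on [A :|: A'] determine those on [A']: every entry below [c], none
    above, and as many copies of [c] as fill the remaining boxes. *)
Lemma garnir_row_equiv : {in A, forall p, c <= val_of (u p)}%N ->
  {in A', forall p, val_of (u p) <= c}%N -> row_equiv t u.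
Proof.
move=> uA uA'.
have cardAA (P : pred (box la)) : #|[set p in A :|: A' | P p]| =
    (#|[set p in A | P p]| + #|[set p in A' | P p]|)%N.
  by rewrite -!sum1dep_card !big_mkcondr /= sum_AA.
have low w : {in A, forall p, c <= val_of (w p)}%N ->
    {in A', forall p, val_of (w p) <= c}%N ->
    forall x, #|[set p in A' | w p == x]| =
     if (val_of x < c)%N then #|[set p in A :|: A' | w p == x]| else
     if (c < val_of x)%N then 0%N else
       (#|A'| - #|[set p in A :|: A' | val_of (w p) < c]|)%N.
  move=> wA wA' x; case: ltnP => [xc|cx].
    rewrite cardAA [X in (X + _)%N]eq_card0 // => p; rewrite inE; apply/negP.
    by move=> /andP[/wA + /eqP e]; rewrite e leqNgt xc.
  case: ltnP => [{}cx|xc].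
    apply: eq_card0 => p; rewrite inE; apply/negP.
    by move=> /andP[/wA' + /eqP e]; rewrite e leqNgt cx.
  rewrite cardAA [X in (X + _)%N]eq_card0 ?add0n; last first.
    by move=> p; rewrite inE; apply/negP => /andP[/wA]; rewrite ltnNge => ->.
  rewrite -(cardsID [set p | val_of (w p) < c]%N A').
  have -> : A' :&: [set p | val_of (w p) < c]%N = [set p in A' | val_of (w p) < c]%N.
    by apply/setP => p; rewrite !inE.
  rewrite addKn; apply: eq_card => p; rewrite !inE andbC.
  case: (boolP (p \in A')) => [/wA' wc|_]; rewrite ?andbF //= !andbT -leqNgt.
  have -> : c = val_of x by apply/eqP; rewrite eqn_leq cx xc.
  apply/eqP/idP => [->|cw]; rewrite ?leqnn //; apply/val_of_inj/eqP.
  by rewrite eqn_leq cw (leq_trans wc).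
have perC (P : pred B) : #|[set p in A :|: A' | P (u p)]| = #|[set p in A :|: A' | P (t p)]|.
  by rewrite uE card_place_perm_on.
have eqA' x : #|[set p in A' | u p == x]| = #|[set p in A' | t p == x]|.
  by rewrite (low u) // (low t) // (perC (pred1 x)) (perC (fun y => val_of y < c)%N).
have eqA x : #|[set p in A | u p == x]| = #|[set p in A | t p == x]|.
  by have := perC (pred1 x); rewrite /= !cardAA eqA' => /addIn.
apply/row_equiv_card => j x.
rewrite (card_splitC (A :|: A')) [RHS](card_splitC (A :|: A')); congr (_ + _)%N; last first.
  apply: eq_card => p; rewrite [LHS]inE [RHS]inE; case: (boolP (p \in A :|: A')) => //= pC.
  congr (_ && _); rewrite uE ffunE.
  move: (groupVr (G := [group of Sym (A :|: A')]) sC).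
  by rewrite inE => /out_perm ->.
rewrite !cardAA; have inR (D : {set box la}) l w : D \subset row_boxes l ->
    #|[set p in D | (row p == j) && (w p == x)]| =
    if l == j then #|[set p in D | w p == x]| else 0%N.
  move=> /subsetP Dl; case: eqP => [<-|lj].
    by apply: eq_card => p; rewrite !inE; case: (boolP (p \in D)) => // /Dl; rewrite inE => ->.
  apply: eq_card0 => p; rewrite inE; apply/negP => /and3P[/Dl + /eqP rp _].
  by rewrite inE rp => /eqP/esym.
by rewrite !(inR _ _ _ Ai) !(inR _ _ _ Ak) eqA eqA'.
Qed.
End GarnirExchange.
End Tableaux.

(** * Alternation and exterior relations *)

Section Alternation.
Variables (G : groupType) (R : comPzRingType) (V : rep G R).
Variables (B : finType) (b : basis B V) (la : seq nat).
Local Notation T := (tableau la B).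
Local Notation tensors := (tensor_rep b (box la)).
Local Notation pure v := (pure_tensor b v : tensors).
Local Notation ext_rel := (@ext_relation G R V B b la).
Implicit Types (t u w : T) (s : {perm box la}) (p q : box la).

Definition alternant (t : T) (x : tensors) : R :=
  \sum_(s in CPP la) (-1) ^+ odd_perm s * x (place t s).

Lemma alternant_scalar t : scalar (alternant t).
Proof.
move=> a x y; rewrite /alternant mulr_sumr -big_split; apply: eq_bigr => s _ /=.
by rewrite !ffunE mulrDr mulrCA.
Qed.
HB.instance Definition _ t :=
  GRing.isLinear.Build R tensors R *%R (alternant t) (alternant_scalar t).

(** The terms of [s] and [s * tperm p q] have equal coefficients and opposite signs. *)
Lemma alternant_pure (v : box la -> V) t p q : p != q -> col p = col q ->
  v p = v q -> alternant t (pure v) = 0.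
Proof.
move=> pq cpq vpq; rewrite /alternant (bigID (@odd_perm _)) /=.
rewrite (reindex_inj (mulIg (tperm p q))) /=.
rewrite -[RHS](@subrr _ (\sum_(s in CPP la | ~~ odd_perm s) pure v (place t s))) addrC.
congr (_ + _).
  by apply: eq_bigr => s /andP[_ /negPf ->]; rewrite expr0 mul1r.
rewrite -sumrN; apply: eq_big => [s|s /andP[_]].
  rewrite odd_permM odd_tperm pq addbT (groupMr (G := CPP_group la)) //.
  exact: tperm_CPP.
rewrite odd_permM odd_tperm pq addbT => ->; rewrite expr1 mulN1r !ffunE; congr (- _).
rewrite (reindex_inj (@perm_inj _ (tperm p q))) /=; apply: eq_bigr => z _.
rewrite place_tperm tpermK; congr (bcoord _ _ _).
by case: tpermP => [->|->|].
Qed.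

Lemma alternant_ext (x : tensors) t : x \in Rspan ext_rel -> alternant t x = 0.
Proof.
move=> /RspanP[l lP ->]; rewrite linear_sum big_seq big1 // => c cl.
have [v [p [q [pq cpq vpq ->]]]] := lP c cl.
by rewrite linearZ /= (alternant_pure _ pq) ?mulr0.
Qed.

(* Polarisation: x ^ y + y ^ x = (x + y) ^ (x + y) - x ^ x - y ^ y. *)
Lemma pure_swap_ext (v : box la -> V) p q : p != q -> col p = col q ->
  pure v + pure (fun z => v (tperm p q z)) \in Rspan ext_rel.
Proof.
move=> pq cpq; pose f x y z := if z == p then x else if z == q then y else v z.
have fE x y t : pure (f x y) t = bcoord b (t p) x * (bcoord b (t q) y *
    \prod_(z | (z != p) && (z != q)) bcoord b (t z) (v z)).
  rewrite ffunE (bigD1 p) //= (bigD1 q) 1?eq_sym //= /f eqxx eq_sym (negPf pq) eqxx.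
  by congr (_ * (_ * _)); apply: eq_bigr => z /andP[/negPf -> /negPf ->].
have same x : pure (f x x) \in Rspan ext_rel.
  apply: mem_Rspan; exists (f x x), p, q; split=> //.
  by rewrite /f eqxx eq_sym (negPf pq) eqxx.
have -> : pure v + pure (fun z => v (tperm p q z)) =
    pure (f (v p + v q) (v p + v q)) - pure (f (v p) (v p)) - pure (f (v q) (v q)).
  have -> : pure v = pure (f (v p) (v q)).
    by congr (pure _); apply/funext => z; rewrite /f; case: eqP => [->//|_]; case: eqP => [->|].
  have -> : pure (fun z => v (tperm p q z)) = pure (f (v q) (v p)).
    congr (pure _); apply/funext => z; rewrite /f; case: tpermP => [->|->|].
    - by rewrite eqxx.
    - by rewrite eq_sym (negPf pq) eqxx.
    - by do 2!move=> /eqP/negPf ->.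
  have addl x x' y : pure (f (x + x') y) = pure (f x y) + pure (f x' y).
    by apply/ffunP => t; rewrite [RHS]ffunE !fE linearD mulrDl.
  have addr x y y' : pure (f x (y + y')) = pure (f x y) + pure (f x y').
    by apply/ffunP => t; rewrite [RHS]ffunE !fE linearD mulrDl mulrDr.
  apply/eqP; rewrite addl !addr -[eqbRHS]addrA -opprD eq_sym subr_eq.
  by rewrite [_ (f (v p) (v p)) + _]addrC addrACA.
by rewrite !rpredB.
Qed.

Lemma tens_swap_ext w p q : p != q -> col p = col q ->
  (tens R w : tensors) + tens R (place w (tperm p q)) \in Rspan ext_rel.
Proof.
move=> pq cpq; rewrite -!(pure_tensor_basis b).
have -> : pure (fun z => b (place w (tperm p q) z)) =
    pure (fun z => b (w (tperm p q z))).
  by congr (pure _); apply/funext => z; rewrite ffunE tpermV.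
exact: (pure_swap_ext (fun z => b (w z))).
Qed.

Lemma tens_repeat_ext w p q : p != q -> col p = col q -> w p = w q ->
  (tens R w : tensors) \in Rspan ext_rel.
Proof.
move=> pq cpq wpq; rewrite -(pure_tensor_basis b); apply: mem_Rspan.
by exists (fun z => b (w z)), p, q; rewrite wpq.
Qed.

(** Swapping [p] and [q] is an involution of [Y]: tableaux with equal entries there are relations by
    themselves, and the others pair up with their swaps. *)
Lemma tens_sum_ext (Y : {set T}) p q : p != q -> col p = col q ->
  (forall w, w \in Y -> place w (tperm p q) \in Y) ->
  \sum_(w in Y) (tens R w : tensors) \in Rspan ext_rel.
Proof.
move=> pq cpq YY; pose tau w : T := place w (tperm p q).
have tauK : involutive tau by move=> w; rewrite -[RHS](placeK (tperm p q) w) tpermV.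
have YE w : (tau w \in Y) = (w \in Y).
  by apply/idP/idP => [/YY|/YY//]; rewrite -/(tau _) tauK.
have tp w : tau w p = w q by rewrite ffunE tpermV tpermL.
have tq w : tau w q = w p by rewrite ffunE tpermV tpermR.
rewrite (bigID (fun w : T => w p == w q)) /=; apply: rpredD.
  by apply: rpred_sum => w /andP[_ /eqP]; exact: tens_repeat_ext.
(* The order of the entries at [p] and [q] selects one tableau from each pair. *)
rewrite (bigID (fun w : T => val_of (w p) < val_of (w q))%N) /= addrC.
rewrite (reindex_inj (inv_inj tauK)) /=.
have e w : [&& tau w \in Y, tau w p != tau w q & ~~ (val_of (tau w p) < val_of (tau w q))%N] =
    [&& w \in Y, w p != w q & (val_of (w p) < val_of (w q))%N].
  rewrite YE tp tq eq_sym; congr andb; case: (eqVneq (w p) (w q)) => //= wpq.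
  by rewrite ltnNge negbK leq_eqVlt (inj_eq (@val_of_inj B)) (negPf wpq).
under eq_bigl => w do rewrite -andbA e.
under [X in _ + X]eq_bigl => w do rewrite -andbA.
rewrite -big_split /=; apply: rpred_sum => w _.
by rewrite addrC tens_swap_ext.
Qed.

End Alternation.

(** Recognising the product as a setwise stabiliser opens the way to orbit counting. *)
Lemma astabs_perm_Sym (X : finType) (C : {set X}) :
  'N(C | 'P)%g = (Sym C * Sym (~: C))%g.
Proof.
apply/setP => s; apply/idP/mulsgP => [sN|[r r' rC rC' ->]].
  exists (restr_perm C s) ((restr_perm C s)^-1 * s)%g; last by rewrite mulKVg.
    by rewrite inE restr_perm_on.
  rewrite inE; apply/subsetP => x; rewrite !inE; apply: contraNN => xC.
  have yC : (restr_perm C s)^-1%g x \in C.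
    by rewrite -(perm_closed _ (restr_perm_on C s)) permKV.
  by rewrite permM -(restr_permE sN yC) permKV.
move: rC rC'; rewrite inE => rC; rewrite inE => rC'.
apply: (groupM (G := [group of 'N(C | 'P)%g])); apply/astabsP => x.
  exact: perm_closed.
by apply: negb_inj; rewrite -!in_setC; exact: perm_closed.
Qed.

(** * Dual Garnir relations *)

Section DualGarnir.
Variables (G : groupType) (R : comPzRingType) (V : rep G R).
Variables (B : finType) (b : basis B V) (la : seq nat).
Local Notation T := (tableau la B).
Local Notation tensors := (tensor_rep b (box la)).
Local Notation ext_rel := (@ext_relation G R V B b la).
Implicit Types (t u w : T) (s r : {perm box la}) (p q : box la).
Implicit Types (A C : {set box la}).

(** A separate name for [val], so that the inclusion into the tensors can be declared linear. *)
Definition low_val (x : Sym_low_rep b la) : tensors := val x.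

Lemma low_val_linear : linear low_val.
Proof. by []. Qed.
HB.instance Definition _ :=
  GRing.isLinear.Build R (Sym_low_rep b la) tensors *:%R low_val low_val_linear.

Lemma low_val_inj : injective low_val.
Proof. exact: val_inj. Qed.

Lemma low_val_rsym t w : low_val (rsym b t) w = (row_equiv t w)%:R.
Proof. by rewrite /low_val /= rsym_tensorE row_orbitE. Qed.

(** Orbit-stabiliser for [rstab u] acting on sets of boxes. *)
Lemma rstab_index u C : #|rstab u : rstab u :&: (Sym C * Sym (~: C))|%g =
  #|[set s @: C | s : {perm box la} in rstab u]|.
Proof.
rewrite -astabs_perm_Sym -astab1_set -(card_orbit _ (rstab_group u)).
by apply: eq_card => D; apply/imsetP/imsetP => -[s sr ->]; exists s.
Qed.

(* The index in the definition is the size of the orbit of C = A :|: A' under the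
   row stabiliser, so D(w) counts the translates of C by row permutations that
   carry a tableau of TT to w. *)
Lemma dual_garnirE t A A' w :
  low_val (dual_garnir b t A A') w =
  #|[set r @: (A :|: A') | r : {perm box la} in [set r in RPP la |
      place w r^-1%g \in [set place t s | s in Sym (A :|: A')]]]|%:R.
Proof.
set C := A :|: A'; set TT := [set place t s | s in Sym C].
pose P := equivalence_partition (@row_equiv la B) TT; pose X := transversal P TT.
have eqr : {in TT & &, equivalence_rel (@row_equiv la B)}.
  move=> u1 u2 u3 _ _ _; split=> [|u12]; first exact: row_equiv_refl.
  by apply/idP/idP; apply: row_equiv_trans; rewrite // row_equiv_sym.
have partP : partition P TT := equivalence_partitionP eqr.
have trX : is_transversal X P TT := transversalP partP.
have XT u : u \in X -> u \in TT := subsetP (transversal_sub trX) u.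
have outC u u' : u \in TT -> u' \in TT -> forall p, p \notin C -> u p = u' p.
  have out u1 : u1 \in TT -> forall p, p \notin C -> u1 p = t p.
    move=> /imsetP[s sC ->] p pC; rewrite ffunE.
    by move: (groupVr (G := [group of Sym C]) sC); rewrite inE => /out_perm ->.
  by move=> uT u'T p pC; rewrite (out u) // (out u').
have -> : low_val (dual_garnir b t A A') w =
    \sum_(u in X) (row_equiv u w)%:R *+ #|[set s @: C | s : {perm box la} in rstab u]|.
  rewrite /dual_garnir raddf_sum sum_ffunE; apply: eq_bigr => u uX.
  by rewrite raddfMn ffunMnE rstab_index low_val_rsym.
(* If no tableau of [TT] is row equivalent to [w], both sides vanish; otherwise only the
   representative [u] of that class contributes. *)
case: (boolP [exists u in TT, row_equiv u w]) => [/exists_inP[u0 u0T u0w]|no]; last first.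
  rewrite big1 => [|u /XT uT]; last first.
    have -> : row_equiv u w = false.
      by apply: contraNF no => uw; apply/exists_inP; exists u.
    by rewrite mul0rn.
  rewrite eq_card0 // => D; apply/negP => /imsetP[r + _].
  rewrite inE => /andP[rR wrT]; case/negP: no; apply/exists_inP; eexists; first exact: wrT.
  rewrite row_equiv_sym; apply/row_equivP; exists r^-1%g => //.
  by rewrite (groupVr (G := RPP_group la)).
have [u uX u0u] : exists2 u, u \in X & row_equiv u0 u.
  have u0P : pblock P u0 \in P by rewrite pblock_mem // (cover_partition partP).
  exists (transversal_repr u0 X (pblock P u0)); first exact: (repr_mem_transversal trX).
  have u1 := repr_mem_pblock trX u0 u0P; have u1X := repr_mem_transversal trX u0 u0P.
  by rewrite -(pblock_equivalence_partition eqr) // XT.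
have uw : row_equiv u w.
  by apply: row_equiv_trans u0w; rewrite row_equiv_sym.
have uT := XT _ uX.
rewrite (bigD1 u) //= uw big1 ?addr0 => [|u' /andP[u'X u'u]]; last first.
  have -> : row_equiv u' w = false; last by rewrite mul0rn.
  apply: contraNF u'u => u'w; apply/eqP/(pblock_inj trX u'X uX).
  apply/eqP; rewrite eq_sym eq_pblock ?(partition_trivIset partP) //; last first.
    by rewrite (cover_partition partP).
  rewrite (pblock_equivalence_partition eqr) ?XT //.
  by apply: row_equiv_trans uw _; rewrite row_equiv_sym.
have /row_equivP[r0 r0R wE] := uw.
(* Translation by [r0] carries the orbit of [C] under [rstab u] onto the set of translates counted
   for [w]. *)
congr (_%:R); rewrite -(card_imset _ (@imset_inj _ _ _ (@perm_inj _ r0))).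
have compE r r' (D : {set box la}) : (r * r')%g @: D = r' @: (r @: D).
  by rewrite -imset_comp; apply: eq_imset => p; rewrite /= permM.
apply: eq_card => D; apply/imsetP/imsetP => [[E /imsetP[s]]|[r]].
  rewrite inE => /andP[sR /eqP us] -> ->; exists (s * r0)%g; last by rewrite compE.
  rewrite inE (groupM (G := RPP_group la)) //=.
  have -> : w = place u (s * r0)%g by rewrite placeM us.
  by rewrite -placeM mulgV place1.
rewrite inE => /andP[rR wrT] ->.
(* The tableaux [u] and [place w r^-1] agree outside [C], so some [s] preserving [C] links them;
   then [s * r] moves [C] as [r] does and factors as an element of [rstab u] times [r0]. *)
have [|s [sR sC e]] := @row_equiv_stab _ _ u (place w r^-1%g) C _ (outC _ _ uT wrT).
  apply: (row_equiv_trans uw); apply/row_equivP; exists r^-1%g => //.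
  by rewrite (groupVr (G := RPP_group la)).
pose s1 := (s * r * r0^-1)%g.
have s1u : s1 \in rstab u.
  rewrite inE !(groupM (G := RPP_group la)) ?(groupVr (G := RPP_group la)) //=.
  by rewrite !placeM -e -[place (place w _) r]placeM mulVg place1 wE -placeM mulgV place1.
exists (s1 @: C); first by apply: imset_f.
by rewrite -compE /s1 mulgKV compE sC.
Qed.

(** Sort the count of [dual_garnirE] by the translate [D] of [C]. Each translate meets two rows in
    boxes [p], [q] of a common column, and the tableaux counted for it are closed under swapping
    them. *)
Lemma DG_ext x : sorted geq la -> x \in DG b la -> low_val x \in Rspan ext_rel.
Proof.
move=> la_dec /RspanP[l lP ->]; rewrite linear_sum big_seq; apply: rpred_sum => c cl.
rewrite linearZ /=; apply: rpredZ.
have [t [i [k [A [A' [ik Ai Ak cAA ->]]]]]] := lP c cl.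
set C := A :|: A'; pose TT := [set place t s | s in Sym C].
pose Y (D : {set box la}) := [set w : T | [exists r in RPP la,
  (r @: C == D) && (place w r^-1%g \in TT)]].
have -> : low_val (dual_garnir b t A A') =
    \sum_(D in [set r @: C | r : {perm box la} in RPP la])
      \sum_(w in Y D) (tens R w : tensors).
  apply/ffunP => w; rewrite dual_garnirE sum_ffunE.
  under eq_bigr => D _ do rewrite sum_ffunE.
  have tensE D : \sum_(w' in Y D) (tens R w' : tensors) w = (w \in Y D)%:R.
    case: (boolP (w \in Y D)) => wD.
      rewrite (bigD1 w) //= ffunE eqxx big1 ?addr0 // => w' /andP[_ /negPf w'w].
      by rewrite ffunE eq_sym w'w.
    rewrite big1 // => w' w'D; rewrite ffunE.
    by case: eqP wD w'D => // -> /negPf ->.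
  under eq_bigr do rewrite tensE.
  rewrite -natr_sum -big_mkcondr sum1_card /=; congr (_%:R); apply: eq_card => D.
  rewrite [RHS]unfold_in /=; apply/imsetP/andP => [[r]|[_]].
    rewrite inE => /andP[rR wT] ->; split; first exact: imset_f.
    by rewrite inE; apply/exists_inP; exists r; rewrite // eqxx.
  rewrite inE => /exists_inP[r rR /andP[/eqP <- wT]].
  by exists r; rewrite // inE rR.
apply: rpred_sum => _ /imsetP[r rR ->].
have rows (l' : 'I_(size la)) (E : {set box la}) :
    E \subset row_boxes l' -> r @: E \subset row_boxes l'.
  move=> El; apply/subsetP => _ /imsetP[p /(subsetP El) + ->].
  by rewrite !inE RPP_row.
have [||p [q [pA qA cpq]]] :=
  @share_column la i k (r @: A) (r @: A') _ (rows _ _ Ai) (rows _ _ Ak).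
- apply: (@sorted_leq_nth _ geq _ _ 0%N _ la_dec i k _ _ (ltnW ik)); rewrite ?inE //.
    by move=> x1 x2 x3 /=; lia.
  by move=> x1 /=.
- by rewrite !card_imset //; exact: perm_inj.
have pq : p != q.
  move: (subsetP (rows _ _ Ai) _ pA) (subsetP (rows _ _ Ak) _ qA); rewrite !inE.
  by move=> /eqP rp /eqP rq; apply: contraTneq ik => pq; rewrite -rp -rq pq ltnn.
apply: (tens_sum_ext _ pq cpq) => w; rewrite !inE => /exists_inP[r' r'R /andP[/eqP r'C]].
move=> /imsetP[s sC e]; apply/exists_inP; exists r' => //; rewrite r'C eqxx /=.
have pC : p \in r' @: C by rewrite r'C /C imsetU inE pA.
have qC : q \in r' @: C by rewrite r'C /C imsetU inE qA orbT.
(* The swap of [p] and [q], pulled back along [r'], only moves boxes of [C]. *)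
apply/imsetP; exists (s * (r' * tperm p q * r'^-1))%g.
  rewrite (groupM (G := [group of Sym C])) // inE; apply/subsetP => z.
  rewrite inE !permM; apply: contraR => xC; rewrite tpermD ?permK //.
    by apply: contraNneq xC => e'; rewrite -(mem_imset _ z (@perm_inj _ r')) -e'.
  by apply: contraNneq xC => e'; rewrite -(mem_imset _ z (@perm_inj _ r')) -e'.
by rewrite placeM -e -[RHS]placeM !mulgA mulVg mul1g placeM.
Qed.

End DualGarnir.

(** * Straightening *)

Section Straightening.
Variables (G : groupType) (R : comPzRingType) (V : rep G R).
Variables (B : finType) (b : basis B V) (la : seq nat).
Local Notation T := (tableau la B).
Local Notation lowval := (@low_val G R V B b la).
Implicit Types (t u w : T) (s r : {perm box la}) (p q : box la).
Implicit Types (x y : Sym_low_rep b la).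

Lemma low_val_row_equiv x t u : row_equiv t u -> lowval x t = lowval x u.
Proof. by case/row_equivP => s sR ->; rewrite (Sym_low_inv (valP x) sR). Qed.

Lemma rsym_row_equiv t u : row_equiv t u -> rsym b t = rsym b u.
Proof.
move=> tu; apply/low_val_inj/ffunP => w; rewrite !low_val_rsym.
suff -> : row_equiv t w = row_equiv u w by [].
by apply/idP/idP; apply: row_equiv_trans; rewrite // row_equiv_sym.
Qed.

Lemma weight_bounded : exists M, forall t : T, (weight t <= M)%N.
Proof. by exists (\max_(t : T) weight t) => u; exact: leq_bigmax. Qed.

(** A row-symmetric tensor is constant on row classes, [rsym] gives their indicator functions, and
    each class has exactly one row-sorted member. *)
Lemma low_sorted_sum x : x = \sum_(t | row_sorted t) lowval x t *: rsym b t.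
Proof.
apply/low_val_inj/ffunP => w; rewrite linear_sum sum_ffunE.
have [t wt st] := row_sorted_exists w.
rewrite (bigD1 t) //= linearZ ffunE low_val_rsym row_equiv_sym wt.
rewrite -(low_val_row_equiv x wt) [_ *: _]mulr1 big1 ?addr0 // => u /andP[su ut].
rewrite linearZ ffunE low_val_rsym.
case: (boolP (row_equiv u w)) => uw; last by rewrite [LHS]mulr0.
by case/eqP: ut; apply: row_sorted_uniq => //; apply: row_equiv_trans uw wt.
Qed.

(** Only the identity contributes: row equivalence preserves the weight, while other column
    permutations lower it. *)
Lemma alternant_rsym_diag t : ssyt t -> alternant t (lowval (rsym b t)) = 1.
Proof.
move=> /andP[_ ct]; rewrite /alternant (bigD1 1%g) /=; last exact: (group1 (CPP_group la)).
rewrite odd_perm1 expr0 mul1r place1 low_val_rsym row_equiv_refl big1 ?addr0 //.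
move=> s /andP[sC s1]; rewrite low_val_rsym;
case: (boolP (row_equiv _ _)) => [ts|_]; last by rewrite mulr0.
by have := weight_CPP ct sC s1; rewrite (weight_row_equiv ts) ltnn.
Qed.

(** The identity would make two sorted tableaux row equivalent, hence equal; any other column
    permutation brings [t] below the weight of [u]. *)
Lemma alternant_rsym_eq0 t u : ssyt t -> ssyt u -> t != u ->
  (weight t <= weight u)%N -> alternant t (lowval (rsym b u)) = 0.
Proof.
move=> /andP[rt ct] /andP[ru cu] tu le_tu; rewrite /alternant big1 // => s sC.
rewrite low_val_rsym; case: (boolP (row_equiv _ _)) => [us|_]; last by rewrite mulr0.
have [s1|s1] := eqVneq s 1%g.
  by case/eqP: tu; apply/esym/row_sorted_uniq => //; rewrite -[t]place1 -s1.
by have := weight_CPP ct sC s1; rewrite (weight_row_equiv us) ltnNge le_tu.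
Qed.

Lemma alternant_low_sum t (P : pred T) (a : T -> R) :
  alternant t (lowval (\sum_(u | P u) a u *: rsym b u)) =
  \sum_(u | P u) alternant t (lowval (rsym b u)) * a u.
Proof.
rewrite (linear_sum lowval) (linear_sum (alternant t)); apply: eq_bigr => u _.
by rewrite linearZ mulrC.
Qed.

Lemma alternant_solve (c : T -> R) : exists a : T -> R,
  forall t, ssyt t -> \sum_(u | ssyt u) alternant t (lowval (rsym b u)) * a u = c t.
Proof.
apply: (unitriangular_solve (r := @weight la B)) => [t|t u]; first exact: alternant_rsym_diag.
exact: alternant_rsym_eq0.
Qed.

(** The transposed matrix is unitriangular for the reversed weight, made a natural number by the
    bound [M]. *)
Lemma alternant_solve_tr (c : T -> R) : exists a : T -> R,
  forall u, ssyt u -> \sum_(t | ssyt t) alternant t (lowval (rsym b u)) * a t = c u.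
Proof.
have [M wM] := weight_bounded.
apply: (unitriangular_solve (N := fun u t => alternant t (lowval (rsym b u)))
  (r := fun t => (M - weight t)%N)) => [t|t u st su tu le]; first exact: alternant_rsym_diag.
by apply: alternant_rsym_eq0; rewrite // 1?eq_sym //; move: (wM t) (wM u) le; lia.
Qed.

(* A and A' are taken to be unions of full classes of equal entries of their rows:
   then rstab t preserves A :|: A' and rsym t has coefficient 1. *)
Lemma garnir_leading t p q : row_sorted t -> col p = col q -> (row p < row q)%N ->
    (val_of (t q) <= val_of (t p))%N ->
  exists D, [/\ D \in DG b la, lowval D t = 1 &
    forall w, lowval D w != 0 -> row_equiv t w \/ (weight t < weight w)%N].
Proof.
move=> /row_sortedP st cpq rpq tqp; set c := val_of (t p).
pose A := [set z | (row z == row p) && (c <= val_of (t z))%N].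
pose A' := [set z | (row z == row q) && (val_of (t z) <= c)%N].
have Ai : A \subset row_boxes (row p) by apply/subsetP => z; rewrite !inE => /andP[].
have Ak : A' \subset row_boxes (row q) by apply/subsetP => z; rewrite !inE => /andP[].
have tA : {in A, forall z, c <= val_of (t z)}%N by move=> z; rewrite inE => /andP[].
have tA' : {in A', forall z, val_of (t z) <= c}%N by move=> z; rewrite inE => /andP[].
(* [A] contains the row of [p] from column [col p] on, and [A'] the row of [q] up to column [col q]
   included. The columns being equal, the sizes exceed the row length by at least one. *)
have cAA : (nth 0%N la (row p) < #|A| + #|A'|)%N.
  have cp := col_lt p; have cq := col_lt q.
  have hA : (nth 0%N la (row p) - col p <= #|A|)%N.
    rewrite -(card_row_ge (ltnW cp)); apply: subset_leq_card; apply/subsetP => z.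
    by rewrite !inE => /andP[/eqP rz cz]; rewrite rz eqxx st.
  have hA' : (col q < #|A'|)%N.
    rewrite -(card_row_le cq); apply: subset_leq_card; apply/subsetP => z.
    by rewrite !inE => /andP[/eqP rz cz]; rewrite rz eqxx (leq_trans _ tqp) // st.
  move: cp cq hA hA'; rewrite -cpq /=; lia.
set C := A :|: A'.
have TT u : u \in [set place t s | s in Sym C] -> (weight t < weight u)%N \/
    {in A, forall z, c <= val_of (u z)}%N /\ {in A', forall z, val_of (u z) <= c}%N.
  by case/imsetP => s sC e; exact: (garnir_weight rpq Ai Ak tA tA' sC e).
exists (dual_garnir b t A A'); split.
- by apply: mem_Rspan; exists t, (row p), (row q), A, A'.
(* A row permutation counted here keeps the weight, so the bounds by [c] survive. Hence it maps [A]
   and [A'] into themselves, and [C] is the only translate. *)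
- rewrite dual_garnirE -/C -[RHS]/(1%:R); congr (_%:R); apply/eqP/cards1P; exists C.
  apply/setP => D; rewrite in_set1; apply/imsetP/eqP => [[r]|->].
    rewrite inE => /andP[rR /TT hu] ->; case: hu => [|[uA uA']].
      rewrite (@weight_row_equiv _ _ t) ?ltnn //; apply/row_equivP; exists r^-1%g => //.
      by rewrite (groupVr (G := RPP_group la)).
    apply/eqP; rewrite eqEcard card_imset ?leqnn ?andbT; last exact: perm_inj.
    apply/subsetP => _ /imsetP[z zC ->]; move: zC; rewrite /C !inE !RPP_row //.
    move=> /orP[] /andP[rz tz]; rewrite rz.
      by have := uA z; rewrite inE rz tz ffunE invgK => -> //.
    by have := uA' z; rewrite inE rz tz ffunE invgK => -> //; rewrite orbT.
  exists 1%g; last by rewrite (eq_imset (g := id)) ?imset_id // => z; rewrite perm1.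
  rewrite inE (group1 (RPP_group la)) invg1 place1 /=.
  by apply/imsetP; exists 1%g; rewrite ?place1 // (group1 [group of Sym C]).
- move=> w; rewrite dual_garnirE -/C => nz.
  have [D] : exists D, D \in [set r @: C | r : {perm box la} in [set r in RPP la |
      place w r^-1%g \in [set place t s | s in Sym C]]].
    by apply/set0Pn; apply: contraNneq nz => ->; rewrite cards0.
  case/imsetP => r; rewrite inE => /andP[rR wT] _.
  have uw : row_equiv (place w r^-1%g) w.
    by rewrite row_equiv_sym; apply/row_equivP; exists r^-1%g;
      rewrite ?(groupVr (G := RPP_group la)).
  rewrite (weight_row_equiv uw); case: (TT _ wT) => [|[uA uA']]; first by right.
  left; apply: row_equiv_trans uw; case/imsetP: wT => s sC e.
  exact: (garnir_row_equiv rpq Ai Ak tA tA' sC e uA uA').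
Qed.

Section Closed.
Variable Q : Sym_low_rep b la -> Prop.
Hypotheses (Q0 : Q 0) (QD : forall x y, Q x -> Q y -> Q (x + y)).
Hypothesis QZ : forall a x, Q x -> Q (a *: x).
Hypotheses (QDG : forall x, x \in DG b la -> Q x) (Qssyt : forall t, ssyt t -> Q (rsym b t)).

Lemma low_support_ind x : (forall w, lowval x w != 0 -> Q (rsym b w)) -> Q x.
Proof.
move=> xQ; rewrite (low_sorted_sum x); apply: (big_ind Q) => // t _.
have [->|nz] := eqVneq (lowval x t) 0; first by rewrite scale0r.
by apply: QZ; exact: xQ.
Qed.

(** Induction from the heaviest tableaux down: a column violation in the sorted form of [t] provides
    the relation of [garnir_leading]. *)
Lemma straighten_rsym t : Q (rsym b t).
Proof.
have [M wM] := weight_bounded.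
have [m] := ubnP (M - weight t); elim: m t => // m IH t.
have [u tu su] := row_sorted_exists t.
rewrite (rsym_row_equiv tu) -(weight_row_equiv tu) ltnS => um.
case: (boolP (col_strict u)) => [cu|]; first by apply: Qssyt; rewrite /ssyt su.
rewrite negb_forall => /existsP[p]; rewrite negb_forall => /existsP[q].
rewrite negb_imply -leqNgt => /andP[/andP[/eqP cpq rpq] uqp].
have [D [DDG D1 Dw]] := garnir_leading su cpq rpq uqp.
(* [D - rsym b u] vanishes on the row class of [u], so its support consists of heavier tableaux. *)
rewrite -[rsym b u](subrK D) -[_ - D]opprB -scaleN1r.
apply: QD; last exact: QDG; apply: QZ; apply: low_support_ind => w.
rewrite linearB !ffunE low_val_rsym; case: (boolP (row_equiv u w)) => uw.
  by rewrite -(low_val_row_equiv D uw) D1 subrr eqxx.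
rewrite subr0 => /Dw[uw'|ltw]; first by rewrite uw' in uw.
by apply: IH; have := wM w; have := wM u; lia.
Qed.

(** An arbitrary predicate [Q] lets straightening serve both for the existence of coefficients and
    for the vanishing of a pairing. *)
Lemma straighten_ind x : Q x.
Proof. by apply: low_support_ind => w _; exact: straighten_rsym. Qed.
End Closed.

Lemma straighten x :
  exists a : T -> R, x - \sum_(t | ssyt t) a t *: rsym b t \in DG b la.
Proof.
apply: (@straighten_ind (fun x => exists a : T -> R,
  x - \sum_(t | ssyt t) a t *: rsym b t \in DG b la))
  => [|y z [a ya] [c zc]|e y [a ya]|y yD|t st].
- by exists (fun=> 0); rewrite big1 ?subrr ?rpred0 // => t _; rewrite scale0r.
- exists (fun t => a t + c t); under eq_bigr do rewrite scalerDl.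
  by rewrite big_split opprD addrACA; exact: rpredD.
- exists (fun t => e * a t); under eq_bigr do rewrite -scalerA.
  by rewrite -scaler_sumr -scalerBr; exact: rpredZ.
- by exists (fun=> 0); rewrite big1 ?subr0 // => t _; rewrite scale0r.
exists (fun u => (u == t)%:R); rewrite (bigD1 t) //= eqxx scale1r big1 ?addr0 ?subrr ?rpred0 //.
by move=> u /andP[_ /negPf ->]; rewrite scale0r.
Qed.

Hypothesis la_dec : sorted geq la.

(** For the converse, [x] is modulo [DG] a semistandard combination [y] whose alternants vanish too,
    and unitriangularity gives [y = 0]. *)
Lemma DG_alternant x :
  x \in DG b la <-> forall t, alternant t (lowval x) = 0.
Proof.
split=> [xD t|alt0]; first by apply: alternant_ext; exact: DG_ext.
have [a xa] := straighten x; set y := \sum_(t | _) _ in xa.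
suff y0 : y = 0 by rewrite y0 subr0 in xa.
have ay t : ssyt t -> \sum_(u | ssyt u) alternant t (lowval (rsym b u)) * a u = 0.
  move=> st; have : alternant t (lowval y) = 0.
    have := alternant_ext t (DG_ext la_dec xa).
    by rewrite linearB [X in X - _](alt0 t) sub0r => /eqP; rewrite oppr_eq0 => /eqP.
  by rewrite alternant_low_sum.
rewrite /y big1 // => t st.
(* Combining the equations [ay] with weights [z], a solution of the transposed system for a unit
   vector, isolates the coefficient [a t]. *)
have [z zE] := alternant_solve_tr (fun u => (u == t)%:R).
have -> : a t = 0; last by rewrite scale0r.
transitivity (\sum_(u | ssyt u)
    (\sum_(t' | ssyt t') alternant t' (lowval (rsym b u)) * z t') * a u).
  under eq_bigr => u su do rewrite zE //.
  rewrite (bigD1 t) //= eqxx mul1r big1 ?addr0 // => u /andP[_ /negPf ->].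
  by rewrite mul0r.
under eq_bigr do rewrite mulr_suml.
rewrite exchange_big big1 //= => t' st'.
transitivity (z t' * \sum_(u | ssyt u) alternant t' (lowval (rsym b u)) * a u).
  by rewrite mulr_sumr; apply: eq_bigr => u _; rewrite mulrCA mulrA.
by rewrite ay ?mulr0.
Qed.

End Straightening.

(** * Finite spans, dual coordinates and coefficients of tensors *)

Lemma Rspan_family (R : comPzRingType) (M : lmodType R) (I : finType) (e : I -> M) z :
  z \in Rspan (fun x => exists i, x = e i) -> exists c : I -> R, z = \sum_i c i *: e i.
Proof.
case/RspanP => s sP ->; elim: s sP => [|p s IH] sP.
  by exists (fun=> 0); rewrite big_nil big1 // => i _; rewrite scale0r.
have [|c cE] := IH; first by move=> q qs; apply: sP; rewrite inE qs orbT.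
have [i pi] : exists i, p.2 = e i by apply: sP; rewrite mem_head.
exists (fun j => p.1 *+ (j == i) + c j); rewrite big_cons cE pi.
under [RHS]eq_bigr do rewrite scalerDl.
rewrite big_split; congr (_ + _); rewrite (bigD1 i) //= eqxx big1 ?addr0 // => j /negPf ->.
by rewrite scale0r.
Qed.

Lemma bcoord_dual (R : comPzRingType) (B : finType) (V : lmodType R) (b : basis B V)
  i (f : dualmod V) : bcoord (dual_basis b) i f = val f (b i).
Proof.
rewrite {2}(bcoordK (dual_basis b) f) [X in _ = X]dual_sumE (bigD1 i) //=.
rewrite bcoord_basis eqxx mulr1 big1 ?addr0 // => j /negPf ji.
by rewrite bcoord_basis ji mulr0.
Qed.

Section TensorCoefficients.
Variables (R : comPzRingType) (B X : finType).
Implicit Types (x y : tensor R B X) (t : {ffun X -> B}).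

Lemma tensorDE x y t : (x + y) t = x t + y t. Proof. by rewrite ffunE. Qed.
Lemma tensorBE x y t : (x - y) t = x t - y t. Proof. by rewrite !ffunE. Qed.
Lemma tensorZE a x t : (a *: x) t = a * x t. Proof. by rewrite ffunE. Qed.
End TensorCoefficients.

(** * The pairing of row-symmetric tensors with symmetric powers *)

Section Pairing.
Variables (G : groupType) (R : comPzRingType) (V W : rep G R).
Variables (B : finType) (b : basis B V) (c : basis B W) (la : seq nat).
Local Notation T := (tableau la B).
Local Notation lowval := (@low_val G R V B b la).
Local Notation sym_rel := (@sym_relation G R W B c la).
Local Notation tensors := (tensor_rep c (box la)).
Implicit Types (x : Sym_low_rep b la) (y z : tensors) (q : Sym_up c la) (t u w : T).

(** Coefficients of [x] are constant under row permutations, so reindexing by [s] identifies the two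
    sums. *)
Lemma pairing_sym_relation x y : y \in Rspan sym_rel -> \sum_t lowval x t * y t = 0.
Proof.
case/RspanP => l lP ->.
under eq_bigr do rewrite sum_ffunE mulr_sumr.
rewrite exchange_big big_seq big1 // => k kl.
have [v [s [sR ->]]] := lP k kl.
have -> : \sum_t lowval x t *
    (k.1 *: (pure_tensor c v - pure_tensor c (fun p => v (s^-1%g p)))) t =
    k.1 * (\sum_t lowval x t * pure_tensor c v t -
           \sum_t lowval x t * pure_tensor c (fun p => v (s^-1%g p)) t).
  rewrite -sumrB mulr_sumr; apply: eq_bigr => t _.
  by rewrite tensorZE tensorBE -mulrBr mulrCA.
rewrite [X in _ - X](reindex (fun t => place t s)) /=; last first.
  exists (fun t => place t s^-1%g) => t _; first exact: placeK.
  by rewrite -placeM mulVg place1.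
rewrite -sumrB big1 ?mulr0 // => t _; apply/eqP; rewrite subr_eq0; apply/eqP.
rewrite [X in X * _](@low_val_row_equiv _ _ _ _ _ _ x t (place t s)); last first.
  by apply/row_equivP; exists s.
congr (_ * _); rewrite !ffunE [RHS](reindex_inj (@perm_inj _ s)) /=.
by apply: eq_bigr => p _; rewrite placeE permK.
Qed.

(** Computed on a chosen representative of [q]; [sym_pairE] shows independence of the choice. *)
Definition sym_pair x q : R := \sum_t lowval x t * (sval (qproj_surj q) : tensors) t.

Lemma sym_pairE x y : sym_pair x (qproj (Rspan sym_rel) y) = \sum_t lowval x t * y t.
Proof.
rewrite /sym_pair; case: qproj_surj => z /= /esym/qproj_eq yz.
apply/eqP; rewrite -subr_eq0 -sumrB; apply/eqP.
transitivity (\sum_t lowval x t * (z - y) t); last exact: pairing_sym_relation.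
by apply: eq_bigr => t _; rewrite tensorBE mulrBr.
Qed.

Lemma sym_pair_scalar x : scalar (sym_pair x).
Proof.
move=> a q r; have [y ->] := qproj_surj q; have [z ->] := qproj_surj r.
have -> : a *: (qproj _ y : Sym_up c la) + qproj _ z = qproj (Rspan sym_rel) (a *: y + z).
  by rewrite linearP.
rewrite !sym_pairE mulr_sumr -big_split; apply: eq_bigr => t _ /=.
by rewrite tensorDE tensorZE mulrDr mulrCA.
Qed.
HB.instance Definition _ x :=
  GRing.isLinear.Build R (Sym_up c la) R *%R (sym_pair x) (sym_pair_scalar x).

Lemma sym_pair_linear q : scalar (sym_pair^~ q).
Proof.
move=> a x x'; rewrite /sym_pair mulr_sumr -big_split; apply: eq_bigr => t _ /=.
by rewrite linearP tensorDE tensorZE mulrDl mulrA.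
Qed.

Lemma sym_pair0l q : sym_pair 0 q = 0.
Proof. by rewrite /sym_pair big1 // => t _; rewrite linear0 ffunE mul0r. Qed.

Lemma sym_pair_class x t : sym_pair x (sym_class c t) = lowval x t.
Proof.
rewrite sym_pairE (bigD1 t) //= ffunE eqxx mulr1 big1 ?addr0 // => u /negPf ut.
by rewrite ffunE ut mulr0.
Qed.

Lemma sym_pair_polytabloid x t : sym_pair x (polytabloid c t) = alternant t (lowval x).
Proof.
rewrite /polytabloid linear_sum; apply: eq_bigr => s _.
by rewrite linearZ /= sym_pair_class.
Qed.

Lemma sym_class_row_equiv t u : row_equiv t u -> sym_class c t = sym_class c u.
Proof.
case/row_equivP => s sR ->; apply/qproj_eq; rewrite -!(pure_tensor_basis c).
apply: mem_Rspan; exists (fun p => c (t p)), s; split=> //; congr (_ - pure_tensor c _).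
by apply/funext => p; rewrite ffunE.
Qed.

(** Replacing tableaux by their sorted forms writes [q] on classes of row-sorted tableaux, and the
    coefficient at [w] is the pairing with [rsym b w]. *)
Lemma sym_pair_nondegenerate q : (forall t, sym_pair (rsym b t) q = 0) -> q = 0.
Proof.
have [y ->] := qproj_surj q => y0.
have [|sr srP] := @boolp.choice T T (fun t u => row_equiv t u /\ row_sorted u).
  by move=> t; have [u] := row_sorted_exists t; exists u.
have -> : qproj (Rspan sym_rel) y = \sum_t y t *: sym_class c (sr t).
  rewrite [in LHS](tensor_sumE y) linear_sum; apply: eq_bigr => t _.
  by rewrite linearZ /=; congr (_ *: _); apply: sym_class_row_equiv; case: (srP t).
rewrite (partition_big sr xpredT) //= big1 // => w _.
under eq_bigr => t /eqP -> do [].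
rewrite -scaler_suml; have [sw|sw] := boolP (row_sorted w); last first.
  by rewrite big_pred0 ?scale0r // => t; apply: contraNF sw => /eqP <-; case: (srP t).
suff -> : \sum_(t | sr t == w) y t = 0 by rewrite scale0r.
have := y0 w; rewrite sym_pairE => {2}<-.
rewrite big_mkcond; apply: eq_bigr => t _; rewrite low_val_rsym row_equiv_sym.
have -> : (sr t == w) = row_equiv t w; last by case: row_equiv; rewrite ?mul1r ?mul0r.
have [tu su] := srP t; apply/eqP/idP => [<-//|tw].
by apply: row_sorted_uniq => //; apply: row_equiv_trans tw; rewrite row_equiv_sym.
Qed.

End Pairing.

(** * The two projections of Sym_la *)

Section Weyl.
Variables (G : groupType) (R : comPzRingType) (V : rep G R).
Variables (B : finType) (b : basis B V) (la : seq nat).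
Hypothesis la_dec : sorted geq la.
Local Notation T := (tableau la B).
Local Notation lowval := (@low_val G R V B b la).
Local Notation c := (dual_basis b : basis B (dual_rep V)).
Local Notation W := (dual_rep V).
Local Notation pairing := (@sym_pair G R V W B b c la).
Implicit Types (x : Sym_low_rep b la) (t u : T).

(** On the dual basis, [g^-1] acts by the transpose of the matrix of [g], factor by factor. *)
Lemma sym_pair_act g x (q : Sym_up c la) :
  pairing (rep_act g x) q = pairing x (rep_act g^-1%g q).
Proof.
have [y ->] := qproj_surj q.
have -> : rep_act g^-1%g (qproj (Rspan (@sym_relation G R W B c la)) y : Sym_up c la) =
    qproj (Rspan (@sym_relation G R W B c la)) (tensor_act c g^-1%g y).
  exact: (quot_actE (@sym_relation_stable G R W B c la)).
rewrite !sym_pairE.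
have actE t : lowval (rep_act g x) t =
    \sum_u lowval x u * \prod_p bcoord b (t p) (rep_act g (b (u p))).
  rewrite /low_val /= /tensor_act sum_ffunE; apply: eq_bigr => u _.
  by rewrite tensorZE ffunE.
have actE' t : tensor_act c g^-1%g y t =
    \sum_u y u * \prod_p bcoord b (u p) (rep_act g (b (t p))).
  rewrite /tensor_act sum_ffunE; apply: eq_bigr => u _.
  rewrite tensorZE ffunE; congr (_ * _); apply: eq_bigr => p _.
  by rewrite bcoord_dual /= invgK.
under eq_bigr do rewrite actE mulr_suml.
under [RHS]eq_bigr do rewrite actE' mulr_sumr.
rewrite exchange_big; apply: eq_bigr => u _; apply: eq_bigr => t _.
by rewrite -mulrA; congr (_ * _); rewrite mulrC.
Qed.

Definition ptab t : polytab_rep c la :=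
  exist (fun q => q \in polytab c la) (polytabloid c t) (mem_Rspan (ex_intro _ t erefl)).

Lemma ptab_span (q : polytab_rep c la) : exists a : T -> R, q = \sum_t a t *: ptab t.
Proof.
have [a aE] := Rspan_family (valP q); exists a; apply: val_inj.
by rewrite aE raddf_sum.
Qed.

Lemma ptab_ssyt t : exists a : T -> R, ptab t = \sum_(s | ssyt s) a s *: ptab s.
Proof.
(* These coefficients make the difference pair to zero with every semistandard [rsym]. Polytabloids
   pair to zero with [DG], so straightening and nondegeneracy finish. *)
have [a aE] := @alternant_solve_tr G R V B b la (fun u => alternant t (lowval (rsym b u))).
exists a; apply/eqP; rewrite -subr_eq0; apply/eqP/val_inj.
set q := val (_ - _); have -> : val (0 : polytab_rep c la) = 0 by [].
have qE : q = polytabloid c t - \sum_(s | ssyt s) a s *: polytabloid c s.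
  by rewrite /q raddfB raddf_sum.
apply: (@sym_pair_nondegenerate G R V W B b c la) => w.
suff all0 x : pairing x q = 0 by [].
have pairE y : pairing y q = alternant t (lowval y) -
    \sum_(s | ssyt s) alternant s (lowval y) * a s.
  rewrite qE linearB /= sym_pair_polytabloid linear_sum; congr (_ - _).
  by apply: eq_bigr => s _; rewrite linearZ /= sym_pair_polytabloid mulrC.
apply: (@straighten_ind G R V B b la (fun x => pairing x q = 0))
  => [|y z y0 z0|d y y0|y yD|u su].
- exact: sym_pair0l.
- by rewrite -[y]scale1r sym_pair_linear y0 z0 mulr0 addr0.
- by rewrite -[d *: y]addr0 sym_pair_linear y0 sym_pair0l mulr0 addr0.
- have /(DG_alternant la_dec) alt0 := yD; rewrite pairE alt0 big1 ?subrr // => s _.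
  by rewrite alt0 mul0r.
by rewrite pairE aE ?subrr.
Qed.

Lemma weyl_form_subproof x :
  (fun q : polytab_rep c la => pairing x (val q)) \in @linear_forms R (polytab_rep c la).
Proof.
by apply/linear_formsP => a q r /=; rewrite linearP.
Qed.

Definition weyl_form x : Weyl b la :=
  @exist _ (fun f => f \in @linear_forms R (polytab_rep c la)) _ (weyl_form_subproof x).

Lemma weyl_formE x t : val (weyl_form x) (ptab t) = alternant t (lowval x).
Proof. exact (@sym_pair_polytabloid G R V W B b c la x t). Qed.

Lemma weyl_form_linear : linear weyl_form.
Proof. by move=> a x y; apply/val_inj/funext => q;
  exact (@sym_pair_linear G R V W B b c la (val q) a x y). Qed.
HB.instance Definition _ :=
  GRing.isLinear.Build R (Sym_low_rep b la) (Weyl b la) *:%R weyl_form weyl_form_linear.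

Lemma weyl_form_act g x : weyl_form (rep_act g x) = rep_act g (weyl_form x).
Proof. by apply/val_inj/funext => q; exact (sym_pair_act g x (val q)). Qed.

Lemma weyl_form_eq (f h : Weyl b la) :
  (forall t, ssyt t -> val f (ptab t) = val h (ptab t)) -> f = h.
Proof.
have lin (k : Weyl b la) (P : pred T) (a : T -> R) :
    val k (\sum_(t | P t) a t *: ptab t) = \sum_(t | P t) a t * val k (ptab t).
  have /linear_formsP kl := valP k.
  pose F : {scalar polytab_rep c la} := HB.pack (val k : polytab_rep c la -> R)
    (GRing.isLinear.Build R (polytab_rep c la) R *%R (val k : polytab_rep c la -> R) kl).
  have kE q : val k q = F q by [].
  by rewrite kE linear_sum; apply: eq_bigr => t _; rewrite linearZ.
move=> fh; apply/val_inj/funext => q; have [a ->] := ptab_span q.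
rewrite !lin; apply: eq_bigr => t _; congr (_ * _); have [d ->] := ptab_ssyt t.
by rewrite !lin; apply: eq_bigr => s ss; rewrite fh.
Qed.

(** Only values on semistandard polytabloids must be matched, and the unitriangular system
    prescribes them freely. *)
Lemma weyl_form_surj (f : Weyl b la) : exists x, weyl_form x = f.
Proof.
have [a aE] := @alternant_solve G R V B b la (fun t => val f (ptab t)).
exists (\sum_(u | ssyt u) a u *: rsym b u); apply: weyl_form_eq => t st.
by rewrite weyl_formE alternant_low_sum aE.
Qed.

Lemma weyl_form_eq0 x : weyl_form x = 0 <-> x \in DG b la.
Proof.
rewrite (DG_alternant la_dec); split=> [x0 t|x0].
  by rewrite -weyl_formE x0.
by apply: weyl_form_eq => t _; rewrite weyl_formE x0.
Qed.

End Weyl.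

(** * The projection onto the copolytabloids *)

Section Copolytabloids.
Variables (G : groupType) (R : comPzRingType) (V : rep G R).
Variables (B : finType) (b : basis B V) (la : seq nat).
Hypothesis la_dec : sorted geq la.
Local Notation ext_rel := (@ext_relation G R V B b la).
Implicit Types (x : Sym_low_rep b la).

Lemma copolytab_class_subproof x : qproj (Rspan ext_rel) (low_val x) \in copolytab b la.
Proof.
rewrite (low_sorted_sum x) !linear_sum; apply: rpred_sum => t _.
rewrite !linearZ; apply: rpredZ; apply: mem_Rspan; exists t.
by rewrite copolytabloidE.
Qed.

Definition copolytab_class x : copolytab_rep b la :=
  exist (fun y => y \in copolytab b la) _ (copolytab_class_subproof x).

Lemma copolytab_class_linear : linear copolytab_class.
Proof. by move=> a x y; apply: val_inj; rewrite /= !linearP. Qed.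
HB.instance Definition _ := GRing.isLinear.Build R (Sym_low_rep b la)
  (copolytab_rep b la) *:%R copolytab_class copolytab_class_linear.

Lemma copolytab_class_act g x :
  copolytab_class (rep_act g x) = rep_act g (copolytab_class x).
Proof.
apply: val_inj; symmetry; exact: (quot_actE (@ext_relation_stable G R V B b la)).
Qed.

Lemma copolytab_class_surj (y : copolytab_rep b la) : exists x, copolytab_class x = y.
Proof.
have [a aE] := Rspan_family (valP y); exists (\sum_t a t *: rsym b t).
apply: val_inj; rewrite aE /= !linear_sum; apply: eq_bigr => t _.
by rewrite !linearZ /= copolytabloidE.
Qed.

(** The kernel is squeezed: it contains [DG], and alternants vanish on it, which forces it back into
    [DG]. *)
Lemma copolytab_class_eq0 x : copolytab_class x = 0 <-> x \in DG b la.
Proof.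
have -> : (copolytab_class x = 0) <-> low_val x \in Rspan ext_rel.
  split=> [/(congr1 val) /= x0|x0].
    by rewrite -[low_val x]subr0; apply/qproj_eq; rewrite x0 linear0.
  by apply: val_inj; rewrite /= -(linear0 (qproj (Rspan ext_rel))); apply/qproj_eq; rewrite subr0.
split=> [x0|]; last exact: DG_ext.
by apply/(DG_alternant la_dec) => t; exact: alternant_ext.
Qed.

(** Stability comes from being the kernel of an equivariant map, without acting on a single
    relation. *)
Lemma DG_stable : stable (DG b la).
Proof.
move=> g x /copolytab_class_eq0 x0; apply/copolytab_class_eq0.
by rewrite copolytab_class_act x0 linear0.
Qed.
End Copolytabloids.

Theorem theorem1p3 (G : groupType) (R : comPzRingType) (V : rep G R)
    (disp : Order.disp_t) (B : finOrderType disp) (b : basis B V)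
    (n : nat) (la : seq nat) (hla : is_partition n la) :
  rep_iso (Weyl b la) (copolytab_rep b la) /\
  exists hDG : stable (DG b la),
    rep_iso (copolytab_rep b la) (quot_rep hDG).
Proof.
have /and3P[la_dec _ _] := hla.
have copE x := @copolytab_class_eq0 G R V B b la la_dec x.
split.
  apply: (@rep_iso_coker _ _ _ _ _ (@weyl_form G R V B b la) (@copolytab_class G R V B b la)).
  - exact: weyl_form_act.
  - exact: copolytab_class_act.
  - exact: (weyl_form_surj la_dec).
  - exact: copolytab_class_surj.
  - by move=> x; rewrite (weyl_form_eq0 la_dec) copE.
exists (DG_stable la_dec).
apply: (@rep_iso_coker _ _ _ _ _ (@copolytab_class G R V B b la)
  (qproj (DG b la) : {linear Sym_low_rep b la -> quot_rep (DG_stable la_dec)})).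
- exact: copolytab_class_act.
- by move=> g x; symmetry; exact: (quot_actE (DG_stable la_dec)).
- exact: copolytab_class_surj.
- by move=> y; have [x ->] := qproj_surj y; exists x.
move=> x; rewrite copE -[X in X \in _]subr0; rewrite -(linear0 (qproj (DG b la))).
by split=> /qproj_eq.
Qed.
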